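(* Let $a,b\in\mathbb D$, $0\le\gamma<2\pi$, $0<\beta<\pi$, $a'=|1+a|-1$, $b'=|1+b|-1$, $\gamma_a=\arg(1+\overline a)$, $\gamma_b=\arg(1+\overline b)$. Suppose $f_1=h_1+\overline{g_1}\in\mathcal S(H^a_\gamma)$ with $h_1(z)+e^{-2i(\gamma+\gamma_a)}g_1(z)=\frac{(1+a')z}{1-e^{i(\gamma+\gamma_a)}z}$, and $f_2=h_2+\overline{g_2}\in\mathcal S(\Omega^b_\beta)$ with $h_2(z)+e^{-2i\gamma_b}g_2(z)=\frac{(1+b')e^{-i\gamma_b}}{2i\sin\beta}\log\left(\frac{1+ze^{i(\beta+\gamma_b)}}{1+ze^{-i(\beta-\gamma_b)}}\right)$. If $f_1*f_2$ is locally univalent in $\mathbb D$, then $f_1*f_2$ is univalent and convex in the direction $-(\gamma+\gamma_a+\gamma_b)$.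
   Context: $\mathbb D$ is the open unit disk. Harmonic $f=h+\overline g$ on $\mathbb D$ ($h,g$ analytic, $g(0)=0$); $\mathcal H$: those with $h(0)=g(0)=0$, $h'(0)=1$; $\mathcal S_H$: sense-preserving ($|h'|>|g'|$) univalent members of $\mathcal H$. $H^a_\gamma=\{w:\mathrm{Re}(\frac{e^{i\gamma}}{1+a}w)>-\frac12\}$, $\mathcal S(H^a_\gamma)=\{f\in\mathcal S_H:f(\mathbb D)=H^a_\gamma\}$; $\Omega^b_\beta=\{w:\frac{\beta-\pi}{2\sin\beta}<\mathrm{Re}(\frac{w}{1+b})<\frac{\beta}{2\sin\beta}\}$, $\mathcal S(\Omega^b_\beta)=\{f\in\mathcal S_H:f(\mathbb D)=\Omega^b_\beta\}$. Harmonic convolution: for $f=\sum a_nz^n+\sum\overline{b_n}\,\overline z^n$, $F=\sum A_nz^n+\sum\overline{B_n}\,\overline z^n$, $f*F=\sum a_nA_nz^n+\sum\overline{b_nB_n}\,\overline z^n$. A univalent map $f$ on $\mathbb D$ is convex in the direction $\alpha\in\mathbb R$ (taken modulo $\pi$) if the intersection of $f(\mathbb D)$ with every line parallel to the line through $0$ and $e^{i\alpha}$ is an interval or empty. Logarithms are principal branches vanishing at $0$. *)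

(* Defs.v *)
From Stdlib Require Import Reals ClassicalEpsilon.
Open Scope R_scope.

Definition Cx := (R * R)%type.
Definition RtoC (x : R) : Cx := (x, 0).
Definition Czero : Cx := (0, 0).
Definition Cone : Cx := (1, 0).
Definition CI : Cx := (0, 1).
Definition Cadd (z w : Cx) : Cx := (fst z + fst w, snd z + snd w).
Definition Copp (z : Cx) : Cx := (- fst z, - snd z).
Definition Csub (z w : Cx) : Cx := Cadd z (Copp w).
Definition Cmul (z w : Cx) : Cx :=
  (fst z * fst w - snd z * snd w, fst z * snd w + snd z * fst w).
Definition Cconj (z : Cx) : Cx := (fst z, - snd z).
Definition Cnorm (z : Cx) : R := sqrt (fst z * fst z + snd z * snd z).
Definition Cinv (z : Cx) : Cx :=
  let d := fst z * fst z + snd z * snd z in (fst z / d, - snd z / d).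
Definition Cdiv (z w : Cx) : Cx := Cmul z (Cinv w).
Definition Re (z : Cx) : R := fst z.
Definition Im (z : Cx) : R := snd z.
Fixpoint Cpow (z : Cx) (n : nat) : Cx :=
  match n with O => Cone | S m => Cmul z (Cpow z m) end.
Definition Cexpi (t : R) : Cx := (cos t, sin t).

(* principal argument, in (-PI, PI] (atan2) *)
Definition Arg (z : Cx) : R :=
  let x := fst z in let y := snd z in
  match Rlt_dec 0 x with
  | left _ => atan (y / x)
  | right _ =>
    match Rlt_dec x 0 with
    | left _ => match Rle_dec 0 y with
                | left _ => atan (y / x) + PI
                | right _ => atan (y / x) - PI end
    | right _ => match Rlt_dec 0 y with
                 | left _ => PI / 2
                 | right _ => match Rlt_dec y 0 with
                              | left _ => - (PI / 2)
                              | right _ => 0 end end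
    end
  end.

Definition Clog (z : Cx) : Cx := (ln (Cnorm z), Arg z).

Definition inD (z : Cx) : Prop := Cnorm z < 1.

Fixpoint psum_part (c : nat -> Cx) (z : Cx) (N : nat) : Cx :=
  match N with
  | O => Cmul (c O) Cone
  | S M => Cadd (psum_part c z M) (Cmul (c N) (Cpow z N))
  end.

Definition HasSum (c : nat -> Cx) (z : Cx) (s : Cx) : Prop :=
  Un_cv (fun N => fst (psum_part c z N)) (fst s) /\
  Un_cv (fun N => snd (psum_part c z N)) (snd s).

(* value of the power series (meaningful when it converges) *)
Definition psum (c : nat -> Cx) (z : Cx) : Cx :=
  epsilon (inhabits Czero) (fun s => HasSum c z s).

Definition analytic_coeffs (c : nat -> Cx) : Prop :=
  forall z, inD z -> exists s, HasSum c z s.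

Definition Cderiv (f : Cx -> Cx) (z l : Cx) : Prop :=
  forall eps, 0 < eps -> exists del, 0 < del /\
    forall w, w <> z -> Cnorm (Csub w z) < del ->
      Cnorm (Csub (Cdiv (Csub (f w) (f z)) (Csub w z)) l) < eps.

(* A harmonic map f = h + conj g on D, with h = sum a_n z^n, g = sum b_n z^n *)
Record harm := Harm { hco : nat -> Cx; gco : nat -> Cx }.
Definition hf (f : harm) : Cx -> Cx := psum (hco f).
Definition gf (f : harm) : Cx -> Cx := psum (gco f).
Definition fval (f : harm) (z : Cx) : Cx := Cadd (hf f z) (Cconj (gf f z)).

Definition is_harmonic_D (f : harm) : Prop :=
  analytic_coeffs (hco f) /\ analytic_coeffs (gco f).

Definition in_H (f : harm) : Prop :=
  is_harmonic_D f /\ hco f 0%nat = Czero /\ gco f 0%nat = Czero /\ hco f 1%nat = Cone.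

Definition sense_preserving (f : harm) : Prop :=
  forall z, inD z -> exists dh dg,
    Cderiv (hf f) z dh /\ Cderiv (gf f) z dg /\ Cnorm dg < Cnorm dh.

Definition univalent_D (F : Cx -> Cx) : Prop :=
  forall z w, inD z -> inD w -> F z = F w -> z = w.

Definition locally_univalent_D (F : Cx -> Cx) : Prop :=
  forall z, inD z -> exists r, 0 < r /\
    forall w1 w2, inD w1 -> inD w2 -> Cnorm (Csub w1 z) < r ->
      Cnorm (Csub w2 z) < r -> F w1 = F w2 -> w1 = w2.

Definition in_SH (f : harm) : Prop :=
  in_H f /\ sense_preserving f /\ univalent_D (fval f).

Definition image_is (F : Cx -> Cx) (Om : Cx -> Prop) : Prop :=
  forall w, (exists z, inD z /\ F z = w) <-> Om w.

Definition Hdom (a : Cx) (gam : R) (w : Cx) : Prop :=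
  Re (Cmul (Cdiv (Cexpi gam) (Cadd Cone a)) w) > - (1/2).
Definition Omdom (b : Cx) (bet : R) (w : Cx) : Prop :=
  (bet - PI) / (2 * sin bet) < Re (Cdiv w (Cadd Cone b)) /\
  Re (Cdiv w (Cadd Cone b)) < bet / (2 * sin bet).

Definition S_H_onto (f : harm) (Om : Cx -> Prop) : Prop :=
  in_SH f /\ image_is (fval f) Om.

Definition hconv (f F : harm) : harm :=
  Harm (fun n => Cmul (hco f n) (hco F n)) (fun n => Cmul (gco f n) (gco F n)).

(* F univalent on D and convex in direction alpha: each line parallel to
   e^{i alpha} meets F(D) in an interval or the empty set *)
Definition convex_in_direction (F : Cx -> Cx) (alpha : R) : Prop :=
  univalent_D F /\
  forall z1 z2, inD z1 -> inD z2 ->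
    Im (Cmul (Cexpi (- alpha)) (Csub (F z2) (F z1))) = 0 ->
    forall t, 0 <= t <= 1 ->
      exists z, inD z /\
        F z = Cadd (F z1) (Cmul (RtoC t) (Csub (F z2) (F z1))).

(* Main.v *)
(** Let [theta = gam + gam_a + gam_b] and let [H + conj G] be the convolution; the imaginary part
    of [e^{i theta} (H + conj G)] is that of [e^{i theta} Q] with [Q = H - e^{-2 i theta} G].

    Write [F_j] for the two prescribed analytic combinations and [k_j] for the combinations with
    the opposite sign; being sense preserving means that [k_j' / F_j'] has positive real part, and
    [2 Q = F_1 * k_2 + F_2 * k_1].  Convolution with the half-plane map [F_1] is a rotation of
    [k_2], and convolution with the strip map [F_2] has a divided difference of [k_1] as its
    derivative; since [F_1] has convex image, that divided difference inherits the positivity.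
    Hence [Q'(z) (1 + e^{i (theta + bet)} z) (1 + e^{i (theta - bet)} z)] has positive real part.

    Uniformise the disk by a vertical strip with coordinate [s + i t], so that [dQ] has positive
    real part with respect to the strip variable: [V = Im (e^{i theta} Q)] is then harmonic and
    strictly increasing in [t].  A barrier argument on long rectangles shows that a value of [V]
    attained above two abscissae [s] is attained above every abscissa in between, so level sets of
    [V] are graphs of continuous functions over intervals.  On such a graph the real part of
    [e^{i theta} (H + conj G)] is continuous and locally injective, hence injective, and its range
    is an interval. *)
From Coquelicot Require Import Rcomplements Rbar Hierarchy Lim_seq Continuity Derive AutoDerive Series PSeries ElemFct.
From Coquelicot Require Complex.
Require Import Defs.
From Stdlib Require Import Reals Lra Psatz ClassicalEpsilon.
Open Scope R_scope.

(* Why [2 Q = F_1 * k_2 + F_2 * k_1]: the products mixing an [h] with a [g] cancel, and the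
   unimodular factors of the two prescribed combinations multiply to [e^{-2 i theta}]. The strip
   variable is dictated by the weight: up to a constant, the inverse of [(1 + e^{i (theta + bet)} z)
   (1 + e^{i (theta - bet)} z)] is the derivative of the logarithm of the quotient of its factors,
   so in that logarithm the weighted positivity of [Q'] is a sign for a plain derivative. The
   obstacle is that the strip is unbounded in [t] and [V] is not assumed bounded: between two
   abscissae a level curve could run off to infinity. Monotonicity in [t] does not exclude this;
   harmonicity does. Local univalence enters only on a level curve, where the imaginary part is
   already fixed. Analytic functions are coefficient sequences, controlled by one quadratic Taylor
   bound and by derivatives along real paths. Harmonicity is read off from separate second
   derivatives, without contour integrals. *)

(* The field of complex numbers, its modulus and the unit circle *)
Declare Scope cx_scope.
Delimit Scope cx_scope with cx.
Infix "+" := Cadd : cx_scope.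
Infix "-" := Csub : cx_scope.
Infix "*" := Cmul : cx_scope.
Infix "/" := Cdiv : cx_scope.
Notation "- z" := (Copp z) : cx_scope.
Infix "^" := Cpow : cx_scope.

Ltac cx_unfold :=
  unfold Cdiv, Csub, Cmul, Cadd, Copp, Cconj, RtoC, Cone, Czero, CI, Re, Im in *; simpl.
Ltac cx_ring := intros; cx_unfold; apply injective_projections; simpl; ring.

Lemma Cx_ring_theory : ring_theory Czero Cone Cadd Cmul Csub Copp (@eq Cx).
Proof. constructor; intros; try (destruct x); cx_ring. Qed.

Lemma sqr_sum_neq0 (z : Cx) : z <> Czero -> fst z * fst z + snd z * snd z <> 0.
Proof.
  intros Hz H. apply Hz. destruct z as [x y]; simpl in *.
  assert (x = 0) by nra. assert (y = 0) by nra. subst. reflexivity.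
Qed.

Lemma Cone_neq0 : Cone <> Czero.
Proof. unfold Cone, Czero. intros H. injection H. lra. Qed.

Lemma Cx_field_theory :
  field_theory Czero Cone Cadd Cmul Csub Copp Cdiv Cinv (@eq Cx).
Proof.
  constructor.
  - exact Cx_ring_theory.
  - exact Cone_neq0.
  - reflexivity.
  - intros z Hz. pose proof (sqr_sum_neq0 z Hz) as H.
    unfold Cinv, Cmul, Cone. apply injective_projections; simpl; field; exact H.
Qed.

Add Field Cx_field : Cx_field_theory.

Lemma Cnorm_Cmod (z : Cx) : Cnorm z = Complex.Cmod z.
Proof. unfold Cnorm, Complex.Cmod. f_equal. ring. Qed.

Lemma Cnorm_triangle (z w : Cx) : Cnorm (z + w)%cx <= Cnorm z + Cnorm w.
Proof. rewrite !Cnorm_Cmod. apply Complex.Cmod_triangle. Qed.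

Lemma Cnorm_mul (z w : Cx) : Cnorm (z * w)%cx = Cnorm z * Cnorm w.
Proof. rewrite !Cnorm_Cmod. apply Complex.Cmod_mult. Qed.

Lemma Cnorm_ge0 (z : Cx) : 0 <= Cnorm z.
Proof. apply sqrt_pos. Qed.

Lemma Cnorm_sqr (z : Cx) : Cnorm z * Cnorm z = fst z * fst z + snd z * snd z.
Proof. unfold Cnorm. apply sqrt_sqrt. nra. Qed.

Lemma Cnorm_gt0 (z : Cx) : z <> Czero -> 0 < Cnorm z.
Proof.
  intros Hz. pose proof (sqr_sum_neq0 z Hz). pose proof (Cnorm_sqr z).
  pose proof (Cnorm_ge0 z). nra.
Qed.

Lemma Cnorm_0 : Cnorm Czero = 0.
Proof. unfold Cnorm, Czero; simpl. replace (0*0+0*0) with 0 by ring. apply sqrt_0. Qed.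

Lemma Cnorm_opp (z : Cx) : Cnorm (- z)%cx = Cnorm z.
Proof. unfold Cnorm, Copp; simpl. f_equal. ring. Qed.

Lemma Cnorm_RtoC (x : R) : Cnorm (RtoC x) = Rabs x.
Proof. unfold Cnorm, RtoC; simpl. rewrite <- sqrt_Rsqr_abs. f_equal. unfold Rsqr. ring. Qed.

Lemma Cnorm_one : Cnorm Cone = 1.
Proof. change Cone with (RtoC 1). rewrite Cnorm_RtoC. apply Rabs_R1. Qed.

Lemma Cnorm_sub_sym (z w : Cx) : Cnorm (z - w)%cx = Cnorm (w - z)%cx.
Proof. rewrite <- Cnorm_opp. f_equal. ring. Qed.

Lemma Cnorm_fst (z : Cx) : Rabs (fst z) <= Cnorm z.
Proof.
  pose proof (Cnorm_sqr z). pose proof (Cnorm_ge0 z). apply Rabs_le. nra.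
Qed.

Lemma Cnorm_snd (z : Cx) : Rabs (snd z) <= Cnorm z.
Proof.
  pose proof (Cnorm_sqr z). pose proof (Cnorm_ge0 z). apply Rabs_le. nra.
Qed.

Lemma Cnorm_le_sum (z : Cx) : Cnorm z <= Rabs (fst z) + Rabs (snd z).
Proof.
  pose proof (Cnorm_sqr z). pose proof (Cnorm_ge0 z).
  pose proof (Rabs_pos (fst z)). pose proof (Rabs_pos (snd z)).
  assert (Rabs (fst z) * Rabs (fst z) = fst z * fst z) by (rewrite <- Rabs_mult; apply Rabs_pos_eq; nra).
  assert (Rabs (snd z) * Rabs (snd z) = snd z * snd z) by (rewrite <- Rabs_mult; apply Rabs_pos_eq; nra).
  nra.
Qed.

Lemma Cnorm_lt_sqr (z : Cx) (r : R) :
  0 <= r -> fst z * fst z + snd z * snd z < r * r -> Cnorm z < r.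
Proof. intros Hr H. pose proof (Cnorm_sqr z). pose proof (Cnorm_ge0 z). nra. Qed.

Lemma Cnorm_pow (z : Cx) (n : nat) : Cnorm (z ^ n)%cx = Cnorm z ^ n.
Proof.
  induction n as [|n IH]; simpl.
  - apply Cnorm_one.
  - rewrite Cnorm_mul, IH. reflexivity.
Qed.

Lemma Cpow_mul (z w : Cx) (n : nat) : ((z * w) ^ n = z ^ n * w ^ n)%cx.
Proof. induction n as [|n IH]; simpl; [|rewrite IH]; ring. Qed.

Lemma Cexpi_add (x y : R) : Cexpi (x + y) = (Cexpi x * Cexpi y)%cx.
Proof.
  unfold Cexpi, Cmul. apply injective_projections; simpl.
  - apply cos_plus.
  - rewrite sin_plus. ring.
Qed.

Lemma Cexpi_0 : Cexpi 0 = Cone.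
Proof. unfold Cexpi, Cone. rewrite cos_0, sin_0. reflexivity. Qed.

Lemma Cnorm_Cexpi (x : R) : Cnorm (Cexpi x) = 1.
Proof.
  unfold Cnorm, Cexpi; simpl. pose proof (sin2_cos2 x) as H. unfold Rsqr in H.
  rewrite Rplus_comm, H. apply sqrt_1.
Qed.

Lemma Cexpi_neq0 (x : R) : Cexpi x <> Czero.
Proof. intros H. pose proof (Cnorm_Cexpi x) as N. rewrite H, Cnorm_0 in N. lra. Qed.

Lemma Cexpi_opp_mul (x : R) : (Cexpi (- x) * Cexpi x)%cx = Cone.
Proof. rewrite <- Cexpi_add, Rplus_opp_l. apply Cexpi_0. Qed.

Lemma Cmul_neq0 (z w : Cx) : z <> Czero -> w <> Czero -> (z * w)%cx <> Czero.
Proof.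
  intros Hz Hw H. pose proof (Cnorm_mul z w) as N. rewrite H, Cnorm_0 in N.
  pose proof (Cnorm_gt0 z Hz). pose proof (Cnorm_gt0 w Hw). nra.
Qed.

Lemma Csub_neq0 (z w : Cx) : z <> w -> (z - w)%cx <> Czero.
Proof.
  intros H E. apply H. replace z with ((z - w) + w)%cx by ring. rewrite E. ring.
Qed.

Lemma one_plus_neq0 (z : Cx) : inD z -> (Cone + z)%cx <> Czero.
Proof.
  unfold inD. intros Hz H. assert (E : z = (- Cone)%cx) by (replace z with ((Cone + z) - Cone)%cx by ring; rewrite H; ring).
  rewrite E, Cnorm_opp, Cnorm_one in Hz. lra.
Qed.

(** * Complex power series on the unit disk *)

Definition CS (c : nat -> Cx) : Cx :=
  (Series (fun n => fst (c n)), Series (fun n => snd (c n))).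
(** Total counterpart of [psum]: componentwise [Series] gives access to the real theory, and the two
    agree on the disk when the coefficients satisfy [summ]. *)
Definition PS (a : nat -> Cx) (z : Cx) : Cx := CS (fun n => a n * z ^ n)%cx.
Definition dco (a : nat -> Cx) (n : nat) : Cx := (RtoC (INR (S n)) * a (S n))%cx.

Definition abs_summable (c : nat -> Cx) : Prop := ex_series (fun n => Cnorm (c n)).
(** Radius of convergence at least one, in a form that is stable under termwise products and
    differentiation. *)
Definition summ (a : nat -> Cx) : Prop :=
  forall r, 0 <= r < 1 -> ex_series (fun n => Cnorm (a n) * r ^ n).

Lemma ex_series_scal_Rl (c : R) (a : nat -> R) :
  ex_series a -> ex_series (fun n => c * a n).
Proof. exact (ex_series_scal (K := R_AbsRing) (V := R_NormedModule) c a). Qed.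

Lemma ex_series_plus_R (a b : nat -> R) :
  ex_series a -> ex_series b -> ex_series (fun n => a n + b n).
Proof. exact (ex_series_plus (K := R_AbsRing) (V := R_NormedModule) a b). Qed.

Lemma abs_summable_le (c : nat -> Cx) (b : nat -> R) :
  (forall n, Cnorm (c n) <= b n) -> ex_series b -> abs_summable c.
Proof.
  intros H Hb. apply (@ex_series_le R_AbsRing R_CompleteNormedModule) with (2 := Hb).
  intros n. change (Rabs (Cnorm (c n)) <= b n). rewrite Rabs_pos_eq; [apply H|apply Cnorm_ge0].
Qed.

Lemma abs_summable_fst (c : nat -> Cx) :
  abs_summable c -> ex_series (fun n => Rabs (fst (c n))).
Proof.
  intros H. apply (@ex_series_le R_AbsRing R_CompleteNormedModule) with (2 := H).
  intros n. change (Rabs (Rabs (fst (c n))) <= Cnorm (c n)). rewrite Rabs_Rabsolu. apply Cnorm_fst.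
Qed.

Lemma abs_summable_snd (c : nat -> Cx) :
  abs_summable c -> ex_series (fun n => Rabs (snd (c n))).
Proof.
  intros H. apply (@ex_series_le R_AbsRing R_CompleteNormedModule) with (2 := H).
  intros n. change (Rabs (Rabs (snd (c n))) <= Cnorm (c n)). rewrite Rabs_Rabsolu. apply Cnorm_snd.
Qed.

Lemma CS_ext (c d : nat -> Cx) : (forall n, c n = d n) -> CS c = CS d.
Proof. intros H. unfold CS. f_equal; apply Series_ext; intros n; rewrite H; reflexivity. Qed.

Lemma CS_add (c d : nat -> Cx) :
  abs_summable c -> abs_summable d -> CS (fun n => c n + d n)%cx = (CS c + CS d)%cx.
Proof.
  intros Hc Hd. unfold CS, Cadd; simpl. f_equal; apply Series_plus;
  apply ex_series_Rabs; auto using abs_summable_fst, abs_summable_snd.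
Qed.

Lemma CS_scal (k : Cx) (c : nat -> Cx) :
  abs_summable c -> CS (fun n => k * c n)%cx = (k * CS c)%cx.
Proof.
  intros Hc. pose proof (ex_series_Rabs _ (abs_summable_fst c Hc)) as H1.
  pose proof (ex_series_Rabs _ (abs_summable_snd c Hc)) as H2.
  unfold CS, Cmul; simpl. apply injective_projections; cbn [fst snd].
  - rewrite <- (Series_scal_l (fst k)), <- (Series_scal_l (snd k)).
    apply Series_minus; apply ex_series_scal_Rl; assumption.
  - rewrite <- (Series_scal_l (fst k)), <- (Series_scal_l (snd k)).
    apply Series_plus; apply ex_series_scal_Rl; assumption.
Qed.

Lemma CS_incr_1 (c : nat -> Cx) :
  abs_summable c -> CS c = (c O + CS (fun n => c (S n)))%cx.
Proof.
  intros Hc. unfold CS, Cadd; cbn [fst snd]. f_equal; apply Series_incr_1;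
  apply ex_series_Rabs; auto using abs_summable_fst, abs_summable_snd.
Qed.

Lemma abs_summable_incr_1 (c : nat -> Cx) :
  abs_summable c -> abs_summable (fun n => c (S n)).
Proof. intros H. apply (ex_series_incr_1 (fun n => Cnorm (c n))). exact H. Qed.

(** The factor 2 comes from bounding the two components separately; later only the existence of some
    constant matters. *)
Lemma CS_norm_le (c : nat -> Cx) (b : nat -> R) :
  (forall n, Cnorm (c n) <= b n) -> ex_series b -> Cnorm (CS c) <= 2 * Series b.
Proof.
  intros H Hb. pose proof (abs_summable_le c b H Hb) as Hc.
  eapply Rle_trans; [apply Cnorm_le_sum|]. unfold CS; cbn [fst snd].
  assert (Rabs (Series (fun n => fst (c n))) <= Series b).
  { eapply Rle_trans; [apply Series_Rabs, abs_summable_fst, Hc|].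
    apply Series_le; [|exact Hb]. intros n. split; [apply Rabs_pos|].
    eapply Rle_trans; [apply Cnorm_fst|apply H]. }
  assert (Rabs (Series (fun n => snd (c n))) <= Series b).
  { eapply Rle_trans; [apply Series_Rabs, abs_summable_snd, Hc|].
    apply Series_le; [|exact Hb]. intros n. split; [apply Rabs_pos|].
    eapply Rle_trans; [apply Cnorm_snd|apply H]. }
  lra.
Qed.

Lemma summ_PS (a : nat -> Cx) (z : Cx) :
  summ a -> inD z -> abs_summable (fun n => a n * z ^ n)%cx.
Proof.
  intros Ha Hz. apply abs_summable_le with (b := fun n => Cnorm (a n) * Cnorm z ^ n).
  - intros n. rewrite Cnorm_mul, Cnorm_pow. lra.
  - apply Ha. split; [apply Cnorm_ge0|exact Hz].
Qed.

(** Bounded terms at the midpoint [(1 + r) / 2] push the radius of convergence strictly beyond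
    [r]. *)
Lemma summ_CV_radius (a : nat -> Cx) (r : R) :
  summ a -> 0 <= r < 1 -> Rbar_lt (Rabs r) (CV_radius (fun n => Cnorm (a n))).
Proof.
  intros Ha Hr. rewrite (Rabs_pos_eq r) by lra.
  apply Rbar_lt_le_trans with (y := Finite ((1 + r) / 2)); [simpl; lra|].
  apply (proj1 (CV_radius_bounded _)).
  assert (Hs : 0 <= (1 + r) / 2 < 1) by lra.
  pose proof (Ha _ Hs) as H. apply ex_series_lim_0, is_lim_seq_Reals in H.
  destruct (maj_by_pos _ (exist _ 0 H)) as [M [_ HM]]. exists M. exact HM.
Qed.

(** Abel's argument: bounded terms at a slightly larger radius, still below 1, are dominated by a
    geometric series at [r]. *)
Lemma summ_of_bounded (a : nat -> Cx) :
  (forall r, 0 <= r < 1 -> exists M, forall n, Cnorm (a n) * r ^ n <= M) -> summ a.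
Proof.
  intros H r Hr.
  assert (L : Rbar_lt (Rabs r) (CV_radius (fun n => Cnorm (a n)))).
  { rewrite (Rabs_pos_eq r) by lra.
    apply Rbar_lt_le_trans with (y := Finite ((1 + r) / 2)); [simpl; lra|].
    apply (proj1 (CV_radius_bounded _)).
    destruct (H ((1 + r) / 2)) as [M HM]; [lra|]. exists M. intros n.
    rewrite Rabs_pos_eq; [apply HM|].
    apply Rmult_le_pos; [apply Cnorm_ge0|apply pow_le; lra]. }
  apply CV_disk_inside in L. revert L. apply ex_series_ext. intros n.
  apply Rabs_pos_eq, Rmult_le_pos; [apply Cnorm_ge0|apply pow_le; lra].
Qed.

Lemma summ_bounded (a : nat -> Cx) (r : R) :
  summ a -> 0 <= r < 1 -> exists M, forall n, Cnorm (a n) * r ^ n <= M.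
Proof.
  intros Ha Hr. pose proof (Ha r Hr) as H. apply ex_series_lim_0, is_lim_seq_Reals in H.
  destruct (maj_by_pos _ (exist _ 0 H)) as [M [_ HM]]. exists M. intros n.
  eapply Rle_trans; [apply Rle_abs|apply HM].
Qed.

Lemma summ_dco (a : nat -> Cx) : summ a -> summ (dco a).
Proof.
  intros Ha r Hr. pose proof (summ_CV_radius a r Ha Hr) as H.
  rewrite <- CV_radius_derive in H. apply CV_disk_inside in H. revert H.
  apply ex_series_ext. intros n. unfold PS_derive, dco.
  rewrite Cnorm_mul, Cnorm_RtoC, (Rabs_pos_eq (INR (S n))) by apply pos_INR.
  apply Rabs_pos_eq. apply Rmult_le_pos; [|apply pow_le; lra].
  apply Rmult_le_pos; [apply pos_INR|apply Cnorm_ge0].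
Qed.

Lemma summ_add (a b : nat -> Cx) : summ a -> summ b -> summ (fun n => a n + b n)%cx.
Proof.
  intros Ha Hb r Hr.
  apply (@ex_series_le R_AbsRing R_CompleteNormedModule)
    with (b := fun n => Cnorm (a n) * r ^ n + Cnorm (b n) * r ^ n).
  - intros n. change (Rabs (Cnorm (a n + b n)%cx * r ^ n) <= Cnorm (a n) * r ^ n + Cnorm (b n) * r ^ n).
    pose proof (pow_le r n (proj1 Hr)). pose proof (Cnorm_ge0 (a n + b n)%cx).
    pose proof (Cnorm_triangle (a n) (b n)). rewrite Rabs_pos_eq; nra.
  - apply ex_series_plus_R; [apply Ha|apply Hb]; exact Hr.
Qed.

(** Writing [r] as [sqrt r * sqrt r] gives each factor a radius below 1 at which its terms are
    bounded. *)
Lemma summ_hadamard (a b : nat -> Cx) : summ a -> summ b -> summ (fun n => a n * b n)%cx.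
Proof.
  intros Ha Hb. apply summ_of_bounded. intros r Hr.
  assert (Hs : 0 <= sqrt r < 1).
  { split; [apply sqrt_pos|]. rewrite <- sqrt_1. apply sqrt_lt_1; lra. }
  destruct (summ_bounded a _ Ha Hs) as [M HM]. destruct (summ_bounded b _ Hb Hs) as [N HN].
  exists (M * N). intros n.
  replace (r ^ n) with (sqrt r ^ n * sqrt r ^ n)
    by (rewrite <- Rpow_mult_distr, sqrt_sqrt; [reflexivity|lra]).
  rewrite Cnorm_mul. specialize (HM n). specialize (HN n).
  pose proof (pow_le _ n (proj1 Hs)).
  pose proof (Cnorm_ge0 (a n)). pose proof (Cnorm_ge0 (b n)).
  replace (Cnorm (a n) * Cnorm (b n) * (sqrt r ^ n * sqrt r ^ n))
    with ((Cnorm (a n) * sqrt r ^ n) * (Cnorm (b n) * sqrt r ^ n)) by ring.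
  apply Rmult_le_compat; try assumption; apply Rmult_le_pos; assumption.
Qed.

Lemma summ_bounded_coeffs (a : nat -> Cx) (M : R) : (forall n, Cnorm (a n) <= M) -> summ a.
Proof.
  intros H. apply summ_of_bounded. intros r Hr. exists M. intros n.
  pose proof (pow_le r n (proj1 Hr)). pose proof (pow_incr r 1 n ltac:(lra)).
  rewrite pow1 in *. pose proof (Cnorm_ge0 (a n)). specialize (H n). nra.
Qed.

Lemma summ_scal (k : Cx) (a : nat -> Cx) : summ a -> summ (fun n => k * a n)%cx.
Proof.
  intros Ha. apply (summ_hadamard (fun _ => k) a); [|exact Ha].
  apply (summ_bounded_coeffs _ (Cnorm k)). intros; lra.
Qed.

Lemma PS_ext (a b : nat -> Cx) (z : Cx) : (forall n, a n = b n) -> PS a z = PS b z.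
Proof. intros H. apply CS_ext. intros n. rewrite H. reflexivity. Qed.

Lemma PS_add (a b : nat -> Cx) (z : Cx) :
  summ a -> summ b -> inD z -> PS (fun n => a n + b n)%cx z = (PS a z + PS b z)%cx.
Proof.
  intros Ha Hb Hz. unfold PS. rewrite <- CS_add by (apply summ_PS; assumption).
  apply CS_ext. intros n. ring.
Qed.

Lemma PS_scal (k : Cx) (a : nat -> Cx) (z : Cx) :
  summ a -> inD z -> PS (fun n => k * a n)%cx z = (k * PS a z)%cx.
Proof.
  intros Ha Hz. unfold PS. rewrite <- CS_scal by (apply summ_PS; assumption).
  apply CS_ext. intros n. ring.
Qed.

Lemma PS_rot (u : Cx) (a : nat -> Cx) (z : Cx) : PS (fun n => u ^ n * a n)%cx z = PS a (u * z)%cx.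
Proof. unfold PS. apply CS_ext. intros n. rewrite Cpow_mul. ring. Qed.

Lemma PS_incr_1 (a : nat -> Cx) (z : Cx) :
  summ a -> inD z -> PS a z = (a O + z * PS (fun n => a (S n)) z)%cx.
Proof.
  intros Ha Hz. pose proof (summ_PS a z Ha Hz) as H. unfold PS at 1.
  rewrite CS_incr_1 by exact H. simpl Cpow at 1.
  destruct (excluded_middle_informative (z = Czero)) as [->|Hn].
  - rewrite (CS_ext _ (fun n => Czero * Czero)%cx) by (intros n; simpl; ring).
    rewrite CS_scal. { ring. }
    apply abs_summable_le with (b := fun n => (1/2) ^ n).
    + intros n. rewrite Cnorm_0. apply pow_le. lra.
    + apply ex_series_geom. rewrite Rabs_pos_eq; lra.
  - unfold PS. rewrite <- CS_scal.
    + replace (a O * Cone)%cx with (a O) by ring. f_equal. apply CS_ext. intros n. simpl. ring.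
    + apply abs_summable_le with (b := fun n => / Cnorm z * Cnorm (a (S n) * z ^ (S n))%cx).
      * intros n. simpl. rewrite !Cnorm_mul. pose proof (Cnorm_gt0 z Hn).
        right. field. lra.
      * apply ex_series_scal_Rl. apply (abs_summable_incr_1 _ H).
Qed.

(** With [e] the remainder for one exponent, the next one is [w e + (n+1) z^n (w - z)^2], which
    drives the induction. Multiplying by [r * r] avoids the exponent [n - 1] of the natural
    bound. *)
Lemma pow_quad_bound (z w : Cx) (r : R) (n : nat) :
  0 < r -> Cnorm z <= r -> Cnorm w <= r ->
  r * r * Cnorm (w ^ S n - z ^ S n - RtoC (INR (S n)) * z ^ n * (w - z))%cx
  <= INR (S n) * INR (S n) * r ^ S n * (Cnorm (w - z)%cx * Cnorm (w - z)%cx).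
Proof.
  intros Hr Hz Hw. induction n as [|n IH].
  - replace (w ^ 1 - z ^ 1 - RtoC (INR 1) * z ^ 0 * (w - z))%cx with Czero
      by (simpl; change (RtoC 1) with Cone; ring).
    rewrite Cnorm_0. pose proof (Cnorm_ge0 (w - z)%cx). simpl. nra.
  - set (e := (w ^ S n - z ^ S n - RtoC (INR (S n)) * z ^ n * (w - z))%cx) in *.
    replace (w ^ S (S n) - z ^ S (S n) - RtoC (INR (S (S n))) * z ^ S n * (w - z))%cx
      with (w * e + RtoC (INR (S n)) * z ^ n * ((w - z) * (w - z)))%cx.
    2: { unfold e. rewrite (S_INR (S n)).
         replace (RtoC (INR (S n) + 1)) with (RtoC (INR (S n)) + Cone)%cx by cx_ring.
         change (w ^ S (S n))%cx with (w * w ^ S n)%cx.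
         change (z ^ S (S n))%cx with (z * (z * z ^ n))%cx.
         change (z ^ S n)%cx with (z * z ^ n)%cx. ring. }
    set (d := Cnorm (w - z)%cx) in *.
    assert (H1 : Cnorm (w * e + RtoC (INR (S n)) * z ^ n * ((w - z) * (w - z)))%cx
       <= r * Cnorm e + INR (S n) * r ^ n * (d * d)).
    { eapply Rle_trans; [apply Cnorm_triangle|]. rewrite !Cnorm_mul, Cnorm_RtoC, Cnorm_pow.
      fold d. rewrite (Rabs_pos_eq (INR (S n))) by apply pos_INR.
      apply Rplus_le_compat.
      - apply Rmult_le_compat_r; [apply Cnorm_ge0|exact Hw].
      - apply Rmult_le_compat_r; [apply Rle_0_sqr|].
        apply Rmult_le_compat_l; [apply pos_INR|]. apply pow_incr. split; [apply Cnorm_ge0|exact Hz]. }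
    assert (Hp : 0 < r ^ n) by (apply pow_lt; exact Hr).
    assert (Hd : 0 <= d) by apply Cnorm_ge0.
    rewrite (S_INR (S n)). set (k := INR (S n)) in *.
    assert (Hk : 0 <= k) by apply pos_INR.
    change (r ^ S (S n)) with (r * (r * r ^ n)). change (r ^ S n) with (r * r ^ n) in IH.
    apply Rle_trans with (r * (k * k * (r * r ^ n) * (d * d)) + r * r * (k * r ^ n * (d * d))).
    + apply Rle_trans with (r * r * (r * Cnorm e + k * r ^ n * (d * d))).
      * apply Rmult_le_compat_l; [nra|exact H1].
      * replace (r * r * (r * Cnorm e + k * r ^ n * (d * d)))
          with (r * (r * r * Cnorm e) + r * r * (k * r ^ n * (d * d))) by ring.
        apply Rplus_le_compat_r. apply Rmult_le_compat_l; [lra|exact IH].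
    + assert (0 <= r * (r * r ^ n) * (d * d) * (k + 1)); [|nra].
      apply Rmult_le_pos; [|lra]. apply Rmult_le_pos; [|nra].
      apply Rmult_le_pos; [lra|]. apply Rmult_le_pos; lra.
Qed.

(** First-order Taylor expansion with a remainder uniform on a smaller closed disk. Continuity, the
    chain rule along paths and the comparison with [Cderiv] all rest on it. *)
Lemma PS_quad (a : nat -> Cx) (r : R) :
  summ a -> 0 < r < 1 ->
  exists M, 0 <= M /\ forall z w, Cnorm z <= r -> Cnorm w <= r ->
    Cnorm (PS a w - PS a z - (w - z) * PS (dco a) z)%cx
    <= M * (Cnorm (w - z)%cx * Cnorm (w - z)%cx).
Proof.
  intros Ha Hr.
  pose (b := fun n => Cnorm (a (S n)) * (INR (S n) * INR (S n)) * r ^ S n / (r * r)).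
  assert (Hb : ex_series b).
  (* After dropping one term, the bounds compare with the second derivative series, because
     [n + 2 <= 2 (n + 1)]. *)
  { apply ex_series_incr_1.
    apply (@ex_series_le R_AbsRing R_CompleteNormedModule)
      with (b := fun n => 2 * (Cnorm (dco (dco a) n) * r ^ n)).
    - intros n. change (Rabs (b (S n)) <= 2 * (Cnorm (dco (dco a) n) * r ^ n)).
      unfold b, dco. rewrite !Cnorm_mul, !Cnorm_RtoC, !(Rabs_pos_eq (INR _)) by apply pos_INR.
      pose proof (Cnorm_ge0 (a (S (S n)))). pose proof (pow_lt r n (proj1 Hr)).
      pose proof (pos_INR n).
      assert (E : Cnorm (a (S (S n))) * (INR (S (S n)) * INR (S (S n))) * r ^ S (S n) / (r * r)
                  = (Cnorm (a (S (S n))) * INR (S (S n)) * r ^ n) * INR (S (S n))).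
      { simpl (r ^ S (S n)). field. lra. }
      rewrite E.
      assert (Hq : 0 <= Cnorm (a (S (S n))) * INR (S (S n)) * r ^ n).
      { apply Rmult_le_pos; [|lra]. apply Rmult_le_pos; [lra|apply pos_INR]. }
      rewrite Rabs_pos_eq by (apply Rmult_le_pos; [exact Hq|apply pos_INR]).
      replace (2 * (INR (S n) * (INR (S (S n)) * Cnorm (a (S (S n)))) * r ^ n))
        with ((Cnorm (a (S (S n))) * INR (S (S n)) * r ^ n) * (2 * INR (S n))) by ring.
      apply Rmult_le_compat_l; [exact Hq|]. rewrite !S_INR. lra.
    - apply ex_series_scal_Rl. apply summ_dco; [apply summ_dco, Ha|lra]. }
  assert (Hb0 : 0 <= Series b).
  { assert (P : forall n, Rabs (b n) = b n).
    { intros n. apply Rabs_pos_eq. unfold b.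
      apply Rmult_le_pos; [|left; apply Rinv_0_lt_compat; nra].
      apply Rmult_le_pos; [|apply pow_le; lra].
      apply Rmult_le_pos; [apply Cnorm_ge0|]. apply Rmult_le_pos; apply pos_INR. }
    rewrite <- (Series_ext _ _ P). eapply Rle_trans; [apply Rabs_pos|apply Series_Rabs].
    revert Hb. apply ex_series_ext. intros n. symmetry. apply P. }
  exists (2 * Series b). split; [lra|]. intros z w Hz Hw.
  assert (Dz : inD z) by (unfold inD; lra). assert (Dw : inD w) by (unfold inD; lra).
  pose proof (summ_PS a z Ha Dz) as Sz. pose proof (summ_PS a w Ha Dw) as Sw.
  pose proof (summ_PS (dco a) z (summ_dco a Ha) Dz) as Sd.
  pose (t := fun n => (a (S n) * (w ^ S n - z ^ S n - RtoC (INR (S n)) * z ^ n * (w - z)))%cx).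
  assert (E : (PS a w - PS a z - (w - z) * PS (dco a) z)%cx = CS t).
  { unfold PS. rewrite (CS_incr_1 _ Sw), (CS_incr_1 _ Sz).
    pose proof (abs_summable_incr_1 _ Sw) as Tw. pose proof (abs_summable_incr_1 _ Sz) as Tz.
    assert (Hs : forall k c, abs_summable c -> abs_summable (fun n => k * c n)%cx).
    { intros k c Hc. apply abs_summable_le with (b := fun n => Cnorm k * Cnorm (c n)).
      - intros n. rewrite Cnorm_mul. lra.
      - apply ex_series_scal_Rl. exact Hc. }
    assert (Hp : forall c d, abs_summable c -> abs_summable d -> abs_summable (fun n => c n + d n)%cx).
    { intros c d Hc Hd. apply abs_summable_le with (b := fun n => Cnorm (c n) + Cnorm (d n)).
      - intros n. apply Cnorm_triangle.
      - apply ex_series_plus_R; assumption. }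
    rewrite (CS_ext t (fun n => a (S n) * w ^ S n
       + ((- Cone) * (a (S n) * z ^ S n) + (- (w - z)) * (dco a n * z ^ n)))%cx)
      by (intros n; unfold t, dco; simpl; ring).
    rewrite !CS_add, !CS_scal; auto. simpl Cpow. ring. }
  rewrite E. set (d := Cnorm (w - z)%cx).
  replace (2 * Series b * (d * d)) with (2 * Series (fun n => b n * (d * d)))
    by (rewrite Series_scal_r; ring).
  apply CS_norm_le.
  - intros n. unfold t, b. rewrite Cnorm_mul.
    pose proof (pow_quad_bound z w r n (proj1 Hr) Hz Hw) as Q. fold d in Q.
    set (e := Cnorm _) in Q at 1. fold e.
    replace (Cnorm (a (S n)) * (INR (S n) * INR (S n)) * r ^ S n / (r * r) * (d * d))
      with (Cnorm (a (S n)) * (INR (S n) * INR (S n) * r ^ S n * (d * d) / (r * r)))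
      by (field; lra).
    apply Rmult_le_compat_l; [apply Cnorm_ge0|].
    apply Rle_div_r; [nra|]. lra.
  - apply ex_series_ext with (a := fun n => d * d * b n); [intros n; apply Rmult_comm|].
    apply ex_series_scal_Rl. exact Hb.
Qed.

(** * Sums in the sense of the statement, and uniqueness of coefficients *)

Lemma psum_part_sum (c : nat -> Cx) (z : Cx) (N : nat) :
  psum_part c z N = (sum_f_R0 (fun n => fst (c n * z ^ n)%cx) N,
                     sum_f_R0 (fun n => snd (c n * z ^ n)%cx) N).
Proof.
  induction N as [|N IH]; [reflexivity|].
  cbn [psum_part]. rewrite IH. reflexivity.
Qed.

Lemma HasSum_series (c : nat -> Cx) (z s : Cx) :
  HasSum c z s <-> is_series (fun n => fst (c n * z ^ n)%cx) (fst s) /\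
                   is_series (fun n => snd (c n * z ^ n)%cx) (snd s).
Proof.
  rewrite !is_series_Reals. unfold HasSum, Un_cv, infinite_sum.
  split; intros [H1 H2]; split; intros e He;
    [destruct (H1 e He) as [N HN]|destruct (H2 e He) as [N HN]
    |destruct (H1 e He) as [N HN]|destruct (H2 e He) as [N HN]];
    exists N; intros n Hn; specialize (HN n Hn); rewrite ?psum_part_sum in *; exact HN.
Qed.

(** Convergence at the real points [r < 1] is enough: terms of a convergent series are bounded. *)
Lemma summ_of_analytic (a : nat -> Cx) : analytic_coeffs a -> summ a.
Proof.
  intros H. apply summ_of_bounded. intros r Hr.
  destruct (H (RtoC r)) as [s Hs]. { unfold inD. rewrite Cnorm_RtoC, Rabs_pos_eq; lra. }
  apply HasSum_series in Hs. destruct Hs as [H1 H2].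
  assert (L1 := ex_series_lim_0 _ (ex_intro _ _ H1)). assert (L2 := ex_series_lim_0 _ (ex_intro _ _ H2)).
  apply is_lim_seq_Reals in L1. apply is_lim_seq_Reals in L2.
  destruct (maj_by_pos _ (exist _ 0 L1)) as [M [_ HM]].
  destruct (maj_by_pos _ (exist _ 0 L2)) as [N [_ HN]].
  exists (M + N). intros n. specialize (HM n). specialize (HN n).
  replace (r ^ n) with (Cnorm (RtoC r ^ n)%cx)
    by (rewrite Cnorm_pow, Cnorm_RtoC, Rabs_pos_eq; [reflexivity|lra]).
  rewrite <- Cnorm_mul. eapply Rle_trans; [apply Cnorm_le_sum|]. lra.
Qed.

Lemma psum_PS (a : nat -> Cx) (z : Cx) : summ a -> inD z -> psum a z = PS a z.
Proof.
  intros Ha Hz. pose proof (summ_PS a z Ha Hz) as H.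
  assert (E : HasSum a z (PS a z)).
  { apply HasSum_series. split; apply Series_correct, ex_series_Rabs;
    auto using abs_summable_fst, abs_summable_snd. }
  assert (E' : HasSum a z (psum a z)) by (apply (epsilon_spec (inhabits Czero) (fun s => HasSum a z s)); eauto).
  destruct E as [E1 E2], E' as [F1 F2].
  apply injective_projections; eapply UL_sequence; eassumption.
Qed.

Lemma summ_fst_CV_radius (a : nat -> Cx) : summ a ->
  Rbar_lt 0 (CV_radius (fun n => fst (a n))) /\ Rbar_lt 0 (CV_radius (fun n => snd (a n))).
Proof.
  intros Ha. destruct (summ_bounded a (1/2) Ha ltac:(lra)) as [M HM].
  split; (apply Rbar_lt_le_trans with (y := Finite (1/2)); [simpl; lra|];
    apply (proj1 (CV_radius_bounded _)); exists M; intros n;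
    rewrite Rabs_mult, (Rabs_pos_eq (_ ^ n)) by (apply pow_le; lra);
    eapply Rle_trans; [|apply (HM n)];
    apply Rmult_le_compat_r; [apply pow_le; lra|]).
  - apply Cnorm_fst.
  - apply Cnorm_snd.
Qed.

Lemma RtoC_pow (x : R) (n : nat) : (RtoC x ^ n)%cx = RtoC (x ^ n).
Proof. induction n as [|n IH]; [reflexivity|]. simpl. rewrite IH. cx_ring. Qed.

(** On the real axis the components of [PS] are real power series, whose coefficients are determined
    near 0. *)
Lemma PS_unique (a b : nat -> Cx) :
  summ a -> summ b -> (forall z, inD z -> PS a z = PS b z) -> forall n, a n = b n.
Proof.
  intros Ha Hb H n.
  destruct (summ_fst_CV_radius a Ha) as [A1 A2]. destruct (summ_fst_CV_radius b Hb) as [B1 B2].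
  assert (E : forall c x, PS c (RtoC x) =
     (PSeries (fun n => fst (c n)) x, PSeries (fun n => snd (c n)) x)).
  { intros c x. unfold PS, CS, PSeries. f_equal; apply Series_ext; intros k;
    rewrite RtoC_pow; unfold RtoC, Cmul; simpl; ring. }
  assert (L : locally (0 : R_UniformSpace) (fun x : R => PS a (RtoC x) = PS b (RtoC x))).
  { exists (mkposreal 1 Rlt_0_1). intros x Hx. apply H. unfold inD. rewrite Cnorm_RtoC.
    change (Rabs (x - 0) < 1) in Hx. rewrite Rminus_0_r in Hx. exact Hx. }
  apply injective_projections.
  - apply (PSeries_ext_recip (fun n => fst (a n)) (fun n => fst (b n))); try assumption.
    revert L. apply filter_imp. intros x Hx. rewrite !E in Hx. injection Hx. auto.
  - apply (PSeries_ext_recip (fun n => snd (a n)) (fun n => snd (b n))); try assumption.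
    revert L. apply filter_imp. intros x Hx. rewrite !E in Hx. injection Hx. auto.
Qed.

(** * Derivatives of complex-valued paths *)

(** Differentiation in a real parameter only, so that the real mean value theorem and real second
    derivatives apply to each component. *)
Definition Cd (p : R -> Cx) (t : R) (l : Cx) : Prop :=
  is_derive (fun x => fst (p x)) t (fst l) /\ is_derive (fun x => snd (p x)) t (snd l).

Lemma is_derive_mul_R (f g : R -> R) (t df dg : R) :
  is_derive f t df -> is_derive g t dg ->
  is_derive (fun x => f x * g x) t (df * g t + f t * dg).
Proof.
  rewrite !is_derive_Reals. exact (derivable_pt_lim_mult f g t df dg).
Qed.

Lemma is_derive_add_R (f g : R -> R) (t df dg : R) :
  is_derive f t df -> is_derive g t dg -> is_derive (fun x => f x + g x) t (df + dg).
Proof. rewrite !is_derive_Reals. exact (derivable_pt_lim_plus f g t df dg). Qed.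

Lemma is_derive_opp_R (f : R -> R) (t df : R) :
  is_derive f t df -> is_derive (fun x => - f x) t (- df).
Proof. rewrite !is_derive_Reals. exact (derivable_pt_lim_opp f t df). Qed.

Lemma is_derive_const_R (c t : R) : is_derive (fun _ : R => c) t 0.
Proof. exact (is_derive_const (V := R_NormedModule) c t). Qed.

Lemma is_derive_id_R (t : R) : is_derive (fun x : R => x) t 1.
Proof. exact (is_derive_id (K := R_AbsRing) t). Qed.

Lemma is_derive_comp_R (f g : R -> R) (t df dg : R) :
  is_derive f (g t) df -> is_derive g t dg -> is_derive (fun x => f (g x)) t (df * dg).
Proof. rewrite !is_derive_Reals. intros Hf Hg. exact (derivable_pt_lim_comp g f t dg df Hg Hf). Qed.

Lemma is_derive_eq (f : R -> R) (t l l' : R) : is_derive f t l -> l = l' -> is_derive f t l'.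
Proof. intros H <-. exact H. Qed.

Lemma Cd_eq (p : R -> Cx) (t : R) (l l' : Cx) : Cd p t l -> l = l' -> Cd p t l'.
Proof. intros H <-. exact H. Qed.

Lemma Cd_ext (p q : R -> Cx) (t : R) (l : Cx) : (forall x, p x = q x) -> Cd p t l -> Cd q t l.
Proof.
  intros H [H1 H2]. split; [revert H1|revert H2]; apply is_derive_ext; intros x; rewrite H; reflexivity.
Qed.

Lemma Cd_ext_loc (p q : R -> Cx) (t : R) (l : Cx) :
  locally (t : R_UniformSpace) (fun x : R => p x = q x) -> Cd p t l -> Cd q t l.
Proof.
  intros H [H1 H2].
  split; [revert H1|revert H2]; apply is_derive_ext_loc; revert H; apply filter_imp;
  intros x ->; reflexivity.
Qed.

Lemma Cd_const (c : Cx) (t : R) : Cd (fun _ => c) t Czero.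
Proof. split; [exact (is_derive_const_R (fst c) t)|exact (is_derive_const_R (snd c) t)]. Qed.

Lemma Cd_add (p q : R -> Cx) (t : R) (l m : Cx) :
  Cd p t l -> Cd q t m -> Cd (fun x => p x + q x)%cx t (l + m)%cx.
Proof. intros [H1 H2] [K1 K2]. split; apply is_derive_add_R; assumption. Qed.

Lemma Cd_opp (p : R -> Cx) (t : R) (l : Cx) : Cd p t l -> Cd (fun x => - p x)%cx t (- l)%cx.
Proof. intros [H1 H2]. split; apply is_derive_opp_R; assumption. Qed.

Lemma Cd_sub (p q : R -> Cx) (t : R) (l m : Cx) :
  Cd p t l -> Cd q t m -> Cd (fun x => p x - q x)%cx t (l - m)%cx.
Proof. intros H K. apply Cd_add; [exact H|apply Cd_opp, K]. Qed.

Lemma Cd_mul (p q : R -> Cx) (t : R) (l m : Cx) :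
  Cd p t l -> Cd q t m -> Cd (fun x => p x * q x)%cx t (l * q t + p t * m)%cx.
Proof.
  intros [H1 H2] [K1 K2]. split; cbn [fst snd Cmul Cadd].
  - eapply is_derive_eq.
    + apply is_derive_add_R; [|apply is_derive_opp_R]; apply is_derive_mul_R; eassumption.
    + simpl; ring.
  - eapply is_derive_eq.
    + apply is_derive_add_R; apply is_derive_mul_R; eassumption.
    + simpl; ring.
Qed.

Lemma Cd_scal (c : Cx) (p : R -> Cx) (t : R) (l : Cx) :
  Cd p t l -> Cd (fun x => c * p x)%cx t (c * l)%cx.
Proof.
  intros H. eapply Cd_eq; [apply Cd_mul; [apply Cd_const|exact H]|]. cbv beta; ring.
Qed.

Lemma Cd_inv (p : R -> Cx) (t : R) (l : Cx) :
  p t <> Czero -> Cd p t l -> Cd (fun x => Cinv (p x)) t (- l * Cinv (p t * p t))%cx.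
Proof.
  intros Hn [H1 H2]. pose proof (sqr_sum_neq0 _ Hn) as Hd.
  assert (HI : is_derive (fun x => / (fst (p x) * fst (p x) + snd (p x) * snd (p x))) t
     (- (2 * (fst l * fst (p t) + snd l * snd (p t)))
        / ((fst (p t) * fst (p t) + snd (p t) * snd (p t)) ^ 2))).
  { apply (is_derive_inv (fun x => fst (p x) * fst (p x) + snd (p x) * snd (p x))); [|exact Hd].
    eapply is_derive_eq; [apply is_derive_add_R; apply is_derive_mul_R; eassumption|]. simpl; ring. }
  split.
  - eapply is_derive_eq; [exact (is_derive_mul_R _ _ _ _ _ H1 HI)|].
    cx_unfold. unfold Cinv; cbn [fst snd]. field.
    split; [|exact Hd]. intros E. apply Hd.
    assert (fst (p t) * fst (p t) - snd (p t) * snd (p t) = 0 /\ fst (p t) * snd (p t) = 0) by nra. nra.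
  - eapply is_derive_eq; [exact (is_derive_mul_R _ _ _ _ _ (is_derive_opp_R _ _ _ H2) HI)|].
    cx_unfold. unfold Cinv; cbn [fst snd]. field.
    split; [|exact Hd]. intros E. apply Hd.
    assert (fst (p t) * fst (p t) - snd (p t) * snd (p t) = 0 /\ fst (p t) * snd (p t) = 0) by nra. nra.
Qed.

Lemma Cd_div (p q : R -> Cx) (t : R) (l m : Cx) :
  q t <> Czero -> Cd p t l -> Cd q t m ->
  Cd (fun x => p x / q x)%cx t ((l * q t - p t * m) / (q t * q t))%cx.
Proof.
  intros Hn Hp Hq. eapply Cd_eq; [apply Cd_mul; [exact Hp|apply Cd_inv; [exact Hn|exact Hq]]|].
  cbv beta. field. exact Hn.
Qed.

Lemma Cd_Cexpi (f : R -> R) (t l : R) :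
  is_derive f t l -> Cd (fun x => Cexpi (f x)) t (RtoC l * (CI * Cexpi (f t)))%cx.
Proof.
  intros H. split; cbn [fst snd Cexpi].
  - eapply is_derive_eq; [apply (is_derive_comp_R cos f); [apply is_derive_Reals, derivable_pt_lim_cos|exact H]|].
    simpl. ring.
  - eapply is_derive_eq; [apply (is_derive_comp_R sin f); [apply is_derive_Reals, derivable_pt_lim_sin|exact H]|].
    simpl. ring.
Qed.

Lemma Cd_RtoC (f : R -> R) (t l : R) : is_derive f t l -> Cd (fun x => RtoC (f x)) t (RtoC l).
Proof. intros H. split; [exact H|exact (is_derive_const_R 0 t)]. Qed.

Lemma Cd_unique (p : R -> Cx) (t : R) (l m : Cx) : Cd p t l -> Cd p t m -> l = m.
Proof.
  intros [H1 H2] [K1 K2].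
  apply is_derive_unique in H1, H2, K1, K2. apply injective_projections; congruence.
Qed.

Lemma Cd_continuous (p : R -> Cx) (t : R) (l : Cx) : Cd p t l ->
  forall e, 0 < e -> exists d, 0 < d /\ forall x, Rabs (x - t) < d -> Cnorm (p x - p t)%cx < e.
Proof.
  intros [H1 H2] e He.
  assert (C1 := ex_derive_continuous _ _ (ex_intro _ _ H1)).
  assert (C2 := ex_derive_continuous _ _ (ex_intro _ _ H2)).
  assert (He2 : 0 < e / 2) by lra.
  pose proof (proj1 (filterlim_locally _ _) C1 (mkposreal _ He2)) as [d1 D1].
  pose proof (proj1 (filterlim_locally _ _) C2 (mkposreal _ He2)) as [d2 D2].
  exists (Rmin d1 d2). split; [apply Rmin_pos; apply cond_pos|]. intros x Hx.
  pose proof (Rmin_l d1 d2). pose proof (Rmin_r d1 d2).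
  assert (B1 := D1 x). assert (B2 := D2 x).
  change (Rabs (x - t) < d1 -> Rabs (fst (p x) - fst (p t)) < e / 2) in B1.
  change (Rabs (x - t) < d2 -> Rabs (snd (p x) - snd (p t)) < e / 2) in B2.
  eapply Rle_lt_trans; [apply Cnorm_le_sum|].
  change (Rabs (fst (p x) - fst (p t)) + Rabs (snd (p x) - snd (p t)) < e).
  specialize (B1 ltac:(lra)). specialize (B2 ltac:(lra)). lra.
Qed.

Lemma is_derive_squeeze0 (f q : R -> R) (t : R) :
  f t = 0 -> q t = 0 -> is_derive q t 0 ->
  (exists d, 0 < d /\ forall x, Rabs (x - t) < d -> Rabs (f x) <= q x) -> is_derive f t 0.
Proof.
  intros Hf Hq Hd [d [Hd0 H]]. apply is_derive_Reals. apply is_derive_Reals in Hd.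
  intros e He. destruct (Hd e He) as [d' Hd'].
  exists (mkposreal _ (Rmin_pos _ _ Hd0 (cond_pos d'))). intros h Hh Hl. simpl in Hl.
  pose proof (Rmin_l d d'). pose proof (Rmin_r d d').
  specialize (Hd' h Hh ltac:(lra)).
  assert (B : Rabs (f (t + h)) <= q (t + h)).
  { apply H. replace (t + h - t) with h by ring. lra. }
  rewrite Hf. rewrite Hq in Hd'.
  eapply Rle_lt_trans; [|exact Hd'].
  replace ((f (t + h) - 0) / h - 0) with (f (t + h) / h) by (field; exact Hh).
  replace ((q (t + h) - 0) / h - 0) with (q (t + h) / h) by (field; exact Hh).
  unfold Rdiv. rewrite !Rabs_mult. apply Rmult_le_compat_r; [apply Rabs_pos|].
  eapply Rle_trans; [exact B|apply Rle_abs].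
Qed.

(** Along the path the series is its affine expansion [A] at [p t] plus a remainder dominated by
    [q], a multiple of [|p x - p t|^2], whose derivative at [t] vanishes. *)
Lemma Cd_PS (a : nat -> Cx) (p : R -> Cx) (t : R) (l : Cx) :
  summ a -> inD (p t) -> Cd p t l ->
  Cd (fun x => PS a (p x)) t (PS (dco a) (p t) * l)%cx.
Proof.
  intros Ha Hp Hd. unfold inD in Hp. pose proof (Cnorm_ge0 (p t)) as Hp0.
  destruct (PS_quad a ((1 + Cnorm (p t)) / 2) Ha ltac:(lra)) as [M [HM HQ]].
  destruct (Cd_continuous p t l Hd ((1 - Cnorm (p t)) / 2) ltac:(lra)) as [d [Hd0 Hc]].
  pose (q := fun x => M * (Cnorm (p x - p t)%cx * Cnorm (p x - p t)%cx)).
  pose (A := fun x => (PS a (p t) + (p x - p t) * PS (dco a) (p t))%cx).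
  assert (HA : Cd A t (PS (dco a) (p t) * l)%cx).
  { eapply Cd_eq.
    - apply Cd_add; [apply Cd_const|apply Cd_mul; [apply Cd_sub; [exact Hd|apply Cd_const]|apply Cd_const]].
    - cbv beta; ring. }
  assert (Hq : is_derive q t 0).
  { destruct Hd as [D1 D2].
    assert (S1 : is_derive (fun x => fst (p x - p t)%cx) t (fst l + - 0))
      by (apply is_derive_add_R; [exact D1|apply is_derive_opp_R, is_derive_const_R]).
    assert (S2 : is_derive (fun x => snd (p x - p t)%cx) t (snd l + - 0))
      by (apply is_derive_add_R; [exact D2|apply is_derive_opp_R, is_derive_const_R]).
    apply is_derive_ext with (f := fun x => M * (fst (p x - p t)%cx * fst (p x - p t)%cx
        + snd (p x - p t)%cx * snd (p x - p t)%cx)).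
    { intros x. unfold q. rewrite Cnorm_sqr. reflexivity. }
    eapply is_derive_eq.
    - apply (is_derive_mul_R (fun _ => M)); [apply is_derive_const_R|].
      apply is_derive_add_R; apply is_derive_mul_R; eassumption.
    - simpl. ring. }
  assert (Eq : q t = 0).
  { unfold q. replace (p t - p t)%cx with Czero by ring. rewrite Cnorm_0. ring. }
  assert (HB : forall x, Rabs (x - t) < d -> Cnorm (PS a (p x) - A x)%cx <= q x).
  { intros x Hx. specialize (Hc x Hx). unfold q, A.
    replace (PS a (p x) - (PS a (p t) + (p x - p t) * PS (dco a) (p t)))%cx
      with (PS a (p x) - PS a (p t) - (p x - p t) * PS (dco a) (p t))%cx by ring.
    apply HQ; [lra|].
    replace (p x) with ((p x - p t) + p t)%cx by ring.
    eapply Rle_trans; [apply Cnorm_triangle|]. lra. }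
  assert (HR : Cd (fun x => PS a (p x) - A x)%cx t Czero).
  { assert (Et : (PS a (p t) - A t)%cx = Czero) by (unfold A; ring).
    split; apply is_derive_squeeze0 with (q := q); try assumption;
      try (rewrite Et; reflexivity); exists d; split; try assumption; intros x Hx;
      (eapply Rle_trans; [|apply HB, Hx]); [apply Cnorm_fst|apply Cnorm_snd]. }
  apply Cd_ext with (p := fun x => (A x + (PS a (p x) - A x))%cx); [intros x; ring|].
  eapply Cd_eq; [apply Cd_add; [exact HA|exact HR]|]. ring.
Qed.

Lemma PS_continuous (a : nat -> Cx) (z : Cx) :
  summ a -> inD z -> forall e, 0 < e -> exists d, 0 < d /\
    forall w, Cnorm (w - z)%cx < d -> inD w /\ Cnorm (PS a w - PS a z)%cx < e.
Proof.
  unfold inD. intros Ha Hz e He. pose proof (Cnorm_ge0 z).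
  destruct (PS_quad a ((1 + Cnorm z) / 2) Ha ltac:(lra)) as [M [HM HQ]].
  set (D := Cnorm (PS (dco a) z)). assert (HD : 0 <= D) by apply Cnorm_ge0.
  exists (Rmin (Rmin 1 ((1 - Cnorm z) / 2)) (e / (M + D + 1))).
  assert (He' : 0 < e / (M + D + 1)) by (apply Rdiv_lt_0_compat; lra).
  split; [apply Rmin_pos; [apply Rmin_pos|]; lra|]. intros w Hw.
  apply Rmin_Rgt_l in Hw. destruct Hw as [Hw Hw3].
  apply Rmin_Rgt_l in Hw. destruct Hw as [Hw1 Hw2].
  assert (Nw : Cnorm w <= Cnorm (w - z)%cx + Cnorm z)
    by (replace w with ((w - z) + z)%cx at 1 by ring; apply Cnorm_triangle).
  split; [lra|]. specialize (HQ z w ltac:(lra) ltac:(lra)).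
  pose proof (Cnorm_ge0 (w - z)%cx). set (x := Cnorm (w - z)%cx) in *.
  replace (PS a w - PS a z)%cx
    with ((PS a w - PS a z - (w - z) * PS (dco a) z) + (w - z) * PS (dco a) z)%cx by ring.
  eapply Rle_lt_trans; [apply Cnorm_triangle|]. rewrite Cnorm_mul. fold x D.
  assert (x * (M + D + 1) < e) by (apply Rlt_div_r; [lra|exact Hw3]).
  assert (x <= 1) by lra. assert (0 <= M * x) by nra. nra.
Qed.

(** A single real increment [h] decides: the difference quotient lies within [e / 2] of [l] by
    [Cderiv] and within [e / 2] of the derived series by [PS_quad], while [e] is the assumed
    distance between the two. *)
Lemma Cderiv_PS (a : nat -> Cx) (f : Cx -> Cx) (z l : Cx) :
  summ a -> inD z -> (forall w, inD w -> f w = PS a w) -> Cderiv f z l -> l = PS (dco a) z.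
Proof.
  intros Ha Hz Hf Hd. unfold inD in Hz. pose proof (Cnorm_ge0 z).
  destruct (PS_quad a ((1 + Cnorm z) / 2) Ha ltac:(lra)) as [M [HM HQ]].
  destruct (excluded_middle_informative (l = PS (dco a) z)) as [E|E]; [exact E|exfalso].
  apply Csub_neq0, Cnorm_gt0 in E. set (e := Cnorm (l - PS (dco a) z)%cx) in *.
  destruct (Hd (e / 2) ltac:(lra)) as [d [Hd0 Hd1]].
  pose (h := Rmin (Rmin (d / 2) ((1 - Cnorm z) / 2)) (e / 2 / (M + 1))).
  assert (He' : 0 < e / 2 / (M + 1)) by (apply Rdiv_lt_0_compat; lra).
  assert (Hh : 0 < h) by (apply Rmin_pos; [apply Rmin_pos|]; lra).
  assert (h1 : h <= d / 2) by (eapply Rle_trans; [apply Rmin_l|apply Rmin_l]).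
  assert (h2 : h <= (1 - Cnorm z) / 2) by (eapply Rle_trans; [apply Rmin_l|apply Rmin_r]).
  assert (h3 : h <= e / 2 / (M + 1)) by apply Rmin_r.
  apply Rle_div_r in h3; [|lra].
  set (w := (z + RtoC h)%cx).
  assert (Ew : (w - z)%cx = RtoC h) by (unfold w; ring).
  assert (Nh : Cnorm (RtoC h) = h) by (rewrite Cnorm_RtoC; apply Rabs_pos_eq; lra).
  assert (Hh0 : RtoC h <> Czero) by (intros X; rewrite X, Cnorm_0 in Nh; lra).
  assert (Hw : Cnorm w <= Cnorm z + h) by (rewrite <- Nh; apply Cnorm_triangle).
  assert (Hne : w <> z) by (intros X; apply Hh0; rewrite <- Ew, X; ring).
  specialize (Hd1 w Hne). rewrite Ew, Nh in Hd1. specialize (Hd1 ltac:(lra)).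
  specialize (HQ z w ltac:(lra) ltac:(lra)). rewrite Ew, Nh in HQ.
  rewrite !Hf in Hd1 by (unfold inD; lra).
  assert (B : Cnorm ((PS a w - PS a z) / RtoC h - PS (dco a) z)%cx <= M * h).
  { apply Rmult_le_reg_r with h; [exact Hh|]. rewrite <- Nh at 2. rewrite <- Cnorm_mul.
    replace (((PS a w - PS a z) / RtoC h - PS (dco a) z) * RtoC h)%cx
      with (PS a w - PS a z - RtoC h * PS (dco a) z)%cx by (field; exact Hh0). lra. }
  assert (T : e <= Cnorm ((PS a w - PS a z) / RtoC h - l)%cx
                   + Cnorm ((PS a w - PS a z) / RtoC h - PS (dco a) z)%cx).
  { rewrite (Cnorm_sub_sym _ l). unfold e.
    replace (l - PS (dco a) z)%cx with ((l - (PS a w - PS a z) / RtoC h)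
       + ((PS a w - PS a z) / RtoC h - PS (dco a) z))%cx by ring.
    apply Cnorm_triangle. }
  nra.
Qed.

(** * The prescribed analytic parts and the sign of the real part *)

Lemma Cdiv_neq0 (z w : Cx) : z <> Czero -> w <> Czero -> (z / w)%cx <> Czero.
Proof.
  intros Hz Hw E. apply Hz. replace z with (z / w * w)%cx by (field; exact Hw). rewrite E. ring.
Qed.

Lemma inD_locally (z : Cx) : inD z ->
  locally (0 : R_UniformSpace) (fun x : R => inD (z + RtoC x)%cx).
Proof.
  unfold inD. intros Hz. assert (Hr : 0 < 1 - Cnorm z) by lra.
  exists (mkposreal _ Hr). intros x Hx. change (Rabs (x - 0) < 1 - Cnorm z) in Hx.
  rewrite Rminus_0_r in Hx. pose proof (Cnorm_triangle z (RtoC x)) as T.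
  rewrite Cnorm_RtoC in T. lra.
Qed.

Lemma Cd_shift (z : Cx) (x : R) : Cd (fun x => z + RtoC x)%cx x Cone.
Proof.
  eapply Cd_eq; [apply Cd_add; [apply Cd_const|apply Cd_RtoC; apply is_derive_id_R]|].
  cx_ring.
Qed.

Lemma add_RtoC_0 (z : Cx) : (z + RtoC 0)%cx = z.
Proof. cx_unfold. apply injective_projections; simpl; ring. Qed.

Lemma PS_dco_unique (a : nat -> Cx) (G : Cx -> Cx) (z l : Cx) :
  summ a -> inD z -> (forall w, inD w -> PS a w = G w) ->
  Cd (fun x => G (z + RtoC x)%cx) 0 l -> PS (dco a) z = l.
Proof.
  intros Ha Hz HG Hl.
  assert (H : Cd (fun x => PS a (z + RtoC x)%cx) 0 (PS (dco a) z)).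
  { eapply Cd_eq.
    - apply Cd_PS; [exact Ha| |apply Cd_shift]. cbv beta; rewrite add_RtoC_0. exact Hz.
    - cbv beta; rewrite add_RtoC_0. ring. }
  apply (Cd_unique _ _ _ _ H). revert Hl. apply Cd_ext_loc.
  generalize (inD_locally z Hz). apply filter_imp. intros x Hx. symmetry. apply HG, Hx.
Qed.

Lemma one_sub_neq0 (u z : Cx) : Cnorm u = 1 -> inD z -> (Cone - u * z)%cx <> Czero.
Proof.
  intros Hu Hz H. apply (one_plus_neq0 (- (u * z))%cx); [|exact H].
  unfold inD in *. rewrite Cnorm_opp, Cnorm_mul, Hu. lra.
Qed.

Lemma summ_pow (u : Cx) : Cnorm u = 1 -> summ (fun n => u ^ n)%cx.
Proof.
  intros Hu. apply (summ_bounded_coeffs _ 1). intros n. rewrite Cnorm_pow, Hu, pow1. lra.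
Qed.

Lemma PS_geom (u z : Cx) : Cnorm u = 1 -> inD z ->
  PS (fun n => u ^ n)%cx z = (Cone / (Cone - u * z))%cx.
Proof.
  intros Hu Hz. pose proof (one_sub_neq0 u z Hu Hz) as Hn.
  assert (E : PS (fun n => u ^ n)%cx z = (Cone + z * (u * PS (fun n => u ^ n) z))%cx).
  { rewrite PS_incr_1 at 1 by (first [assumption | apply summ_pow; assumption]).
    rewrite <- (PS_scal u (fun n => u ^ n)%cx z) by (first [assumption | apply summ_pow; assumption]). reflexivity. }
  set (g := PS (fun n => u ^ n)%cx z) in *.
  replace g with ((g - z * (u * g)) / (Cone - u * z))%cx by (field; exact Hn).
  rewrite E at 1. f_equal. ring.
Qed.

Lemma half_plane_coeffs (c : nat -> Cx) (A u : Cx) :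
  summ c -> Cnorm u = 1 ->
  (forall z, inD z -> PS c z = (A * z / (Cone - u * z))%cx) ->
  forall n, c (S n) = (A * u ^ n)%cx.
Proof.
  intros Hc Hu H.
  pose (d := fun n => match n with O => Czero | S m => (A * u ^ m)%cx end).
  assert (Hd : summ d).
  { apply (summ_bounded_coeffs _ (Cnorm A)). intros [|n]; simpl.
    - rewrite Cnorm_0. apply Cnorm_ge0.
    - rewrite Cnorm_mul, Cnorm_pow, Hu, pow1. lra. }
  intros n. change (A * u ^ n)%cx with (d (S n)). apply PS_unique; try assumption.
  intros z Hz. rewrite H by exact Hz. rewrite PS_incr_1 by assumption. simpl.
  rewrite PS_scal, PS_geom by (first [assumption | apply summ_pow; assumption]).
  field. apply one_sub_neq0; assumption.
Qed.

(** Partial fractions reduce to two geometric series. The lemma is meant for the derivative of the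
    strip map, which is rational while the map is a logarithm. *)
Lemma strip_coeffs (d : nat -> Cx) (B u v : Cx) :
  summ d -> Cnorm u = 1 -> Cnorm v = 1 -> u <> v ->
  (forall z, inD z -> PS d z = (B / ((Cone - u * z) * (Cone - v * z)))%cx) ->
  forall n, d n = (B / (u - v) * (u ^ S n - v ^ S n))%cx.
Proof.
  intros Hd Hu Hv Huv H.
  pose proof (summ_scal (B / (u - v) * u)%cx _ (summ_pow u Hu)) as Su.
  pose proof (summ_scal (- (B / (u - v) * v))%cx _ (summ_pow v Hv)) as Sv.
  intros n.
  transitivity ((B / (u - v) * u) * u ^ n + (- (B / (u - v) * v)) * v ^ n)%cx; [|simpl; ring].
  apply (PS_unique d (fun n => (B / (u - v) * u) * u ^ n + (- (B / (u - v) * v)) * v ^ n)%cx);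
    [exact Hd|apply summ_add; assumption|].
  intros z Hz. rewrite H by exact Hz. rewrite PS_add by assumption.
  rewrite !PS_scal by (first [assumption | apply summ_pow; assumption]). rewrite !PS_geom by assumption.
  field. repeat split; try (apply one_sub_neq0; assumption). apply Csub_neq0, Huv.
Qed.

Definition Cexp (z : Cx) : Cx := (RtoC (exp (fst z)) * Cexpi (snd z))%cx.

Lemma Cd_Cexp (p : R -> Cx) (t : R) (l : Cx) :
  Cd p t l -> Cd (fun x => Cexp (p x)) t (Cexp (p t) * l)%cx.
Proof.
  intros [H1 H2]. unfold Cexp. eapply Cd_eq.
  - apply Cd_mul; [apply Cd_RtoC|apply Cd_Cexpi; exact H2].
    apply (is_derive_comp_R exp (fun x => fst (p x))); [|exact H1].
    apply is_derive_Reals, derivable_pt_lim_exp.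
  - cx_unfold. apply injective_projections; simpl; ring.
Qed.

Lemma sqrt_sqr_sum_neg (x y : R) : x < 0 ->
  sqrt (x * x + y * y) = - x * sqrt (1 + (y / x)²).
Proof.
  intros Hx. replace (x * x + y * y) with (- x * - x * (1 + (y / x)²)) by (unfold Rsqr; field; lra).
  rewrite sqrt_mult_alt, sqrt_square by nra. reflexivity.
Qed.

Lemma sqrt_sqr_sum_pos (x y : R) : 0 < x ->
  sqrt (x * x + y * y) = x * sqrt (1 + (y / x)²).
Proof.
  intros Hx. replace (x * x + y * y) with (x * x * (1 + (y / x)²)) by (unfold Rsqr; field; lra).
  rewrite sqrt_mult_alt, sqrt_square by nra. reflexivity.
Qed.

(** The case split follows [Arg]: the shifts by [PI] compensate the sign lost in [atan (y / x)] for
    negative [x]. *)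
Lemma Cexp_Clog (w : Cx) : w <> Czero -> Cexp (Clog w) = w.
Proof.
  intros Hw. unfold Cexp, Clog. cbn [fst snd]. rewrite exp_ln by (apply Cnorm_gt0, Hw).
  destruct w as [x y]. unfold Cnorm, Arg; cbn [fst snd].
  assert (Q : forall q, sqrt (1 + q²) <> 0).
  { intros q. apply Rgt_not_eq, sqrt_lt_R0. pose proof (Rle_0_sqr q). lra. }
  destruct (Rlt_dec 0 x) as [Hx|Hx].
  - rewrite sqrt_sqr_sum_pos by exact Hx. unfold Cexpi. rewrite cos_atan, sin_atan.
    cx_unfold. apply injective_projections; simpl; field; split; auto; lra.
  - destruct (Rlt_dec x 0) as [Hx'|Hx'].
    + rewrite sqrt_sqr_sum_neg by exact Hx'.
      assert (G : (RtoC (- x * sqrt (1 + (y / x)²)) * (- Cexpi (atan (y / x))))%cx = (x, y)).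
      { unfold Cexpi. rewrite cos_atan, sin_atan.
        cx_unfold. apply injective_projections; simpl; field; split; auto; lra. }
      destruct (Rle_dec 0 y); rewrite <- G; f_equal; unfold Cexpi, Copp; simpl; f_equal.
      * rewrite neg_cos. reflexivity.
      * rewrite neg_sin. reflexivity.
      * rewrite cos_minus, cos_PI, sin_PI. ring.
      * rewrite sin_minus, cos_PI, sin_PI. ring.
    + assert (x = 0) by lra. subst x. unfold Cexpi.
      replace (0 * 0 + y * y) with (y * y) by ring.
      destruct (Rlt_dec 0 y).
      * rewrite sqrt_square, cos_PI2, sin_PI2 by lra. cx_unfold. f_equal; ring.
      * destruct (Rlt_dec y 0).
        -- replace (y * y) with (- y * - y) by ring.
           rewrite sqrt_square, cos_neg, sin_neg, cos_PI2, sin_PI2 by lra. cx_unfold. f_equal; ring.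
        -- exfalso. apply Hw. unfold Czero. f_equal. lra.
Qed.

(** The branch of the logarithm is never differentiated: the series is differentiable anyway, so
    both sides are exponentiated and the derivatives of the resulting identity compared. *)
Lemma log_quotient_deriv (c : nat -> Cx) (K u v : Cx) :
  summ c -> Cnorm u = 1 -> Cnorm v = 1 -> K <> Czero ->
  (forall z, inD z -> PS c z = (K * Clog ((Cone - u * z) / (Cone - v * z)))%cx) ->
  forall z, inD z ->
    PS (dco c) z = (K * (v - u) / ((Cone - u * z) * (Cone - v * z)))%cx.
Proof.
  intros Hc Hu Hv HK H z Hz.
  pose proof (one_sub_neq0 u z Hu Hz) as Nu. pose proof (one_sub_neq0 v z Hv Hz) as Nv.
  assert (HE : forall w, inD w ->
    Cexp (Cinv K * PS c w)%cx = ((Cone - u * w) / (Cone - v * w))%cx).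
  { intros w Hw. pose proof (one_sub_neq0 u w Hu Hw). pose proof (one_sub_neq0 v w Hv Hw) as Nw.
    rewrite H by exact Hw.
    replace (Cinv K * (K * Clog ((Cone - u * w) / (Cone - v * w))))%cx
      with (Clog ((Cone - u * w) / (Cone - v * w))%cx) by (field; auto).
    apply Cexp_Clog. apply Cdiv_neq0; assumption. }
  assert (D1 : Cd (fun x => Cexp (Cinv K * PS c (z + RtoC x)))%cx 0
     ((Cone - u * z) / (Cone - v * z) * (Cinv K * PS (dco c) z))%cx).
  { eapply Cd_eq.
    - apply Cd_Cexp, Cd_scal, Cd_PS; [exact Hc| |apply Cd_shift]. cbv beta; rewrite add_RtoC_0. exact Hz.
    - cbv beta; rewrite add_RtoC_0, HE by exact Hz. ring. }
  assert (D2 : Cd (fun x => Cexp (Cinv K * PS c (z + RtoC x)))%cx 0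
     ((v - u) / ((Cone - v * z) * (Cone - v * z)))%cx).
  { apply Cd_ext_loc with (p := fun x => ((Cone - u * (z + RtoC x)) / (Cone - v * (z + RtoC x)))%cx).
    - generalize (inD_locally z Hz). apply filter_imp. intros x Hx. symmetry. apply HE, Hx.
    - eapply Cd_eq.
      + apply Cd_div; [cbv beta; rewrite add_RtoC_0; exact Nv| |];
        (apply Cd_sub; [apply Cd_const|apply Cd_scal, Cd_shift]).
      + cbv beta; rewrite add_RtoC_0. field. exact Nv. }
  pose proof (Cd_unique _ _ _ _ D1 D2) as E.
  replace (PS (dco c) z) with (((Cone - u * z) / (Cone - v * z) * (Cinv K * PS (dco c) z))
     * (K * (Cone - v * z) / (Cone - u * z)))%cx by (field; auto).
  rewrite E. field. auto.
Qed.

Lemma half_plane_deriv (c : nat -> Cx) (A u : Cx) :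
  summ c -> Cnorm u = 1 ->
  (forall z, inD z -> PS c z = (A * z / (Cone - u * z))%cx) ->
  forall z, inD z -> PS (dco c) z = (A / ((Cone - u * z) * (Cone - u * z)))%cx.
Proof.
  intros Hc Hu H z Hz. pose proof (one_sub_neq0 u z Hu Hz) as Nu.
  apply (PS_dco_unique c (fun z => A * z / (Cone - u * z))%cx); try assumption.
  eapply Cd_eq.
  - apply Cd_div; [cbv beta; rewrite add_RtoC_0; exact Nu|apply Cd_scal, Cd_shift|].
    apply Cd_sub; [apply Cd_const|apply Cd_scal, Cd_shift].
  - cbv beta; rewrite add_RtoC_0. field. exact Nu.
Qed.

(** * Positivity of real parts from sense preservation *)

(** The conjugate of [B / q] is [q] times the positive number [B / |q|^2]. *)
Lemma Re_ratio_pos (k q : Cx) (B : R) : 0 < B -> q <> Czero ->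
  0 < fst (k * Cconj (RtoC B / q))%cx -> 0 < fst (k * q)%cx.
Proof.
  intros HB Hq H. pose proof (sqr_sum_neq0 q Hq) as Hn.
  assert (0 < fst q * fst q + snd q * snd q) by nra.
  assert (E : fst (k * Cconj (RtoC B / q))%cx
     = B / (fst q * fst q + snd q * snd q) * fst (k * q)%cx).
  { unfold Cinv. cx_unfold. unfold Cinv; cbn [fst snd]. field. lra. }
  rewrite E in H. assert (0 < B / (fst q * fst q + snd q * snd q)) by (apply Rdiv_lt_0_compat; lra).
  nra.
Qed.

(** The cross terms are a number minus its conjugate, hence purely imaginary; [|h|^2 - |e g|^2]
    remains. *)
Lemma sense_preserving_Re_pos (h g e : Cx) : Cnorm e = 1 -> Cnorm g < Cnorm h ->
  0 < fst ((h - e * g) * Cconj (h + e * g))%cx.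
Proof.
  intros He Hgh.
  assert (E : fst ((h - e * g) * Cconj (h + e * g))%cx
     = Cnorm h * Cnorm h - (Cnorm e * Cnorm e) * (Cnorm g * Cnorm g)).
  { rewrite !Cnorm_sqr. cx_unfold. ring. }
  rewrite E, He. pose proof (Cnorm_ge0 g). nra.
Qed.

(* The Moebius map [w = z / (1 - u z)] sends the disk onto a half-plane; in that variable [k] has
   a derivative of positive real part, and half-planes are convex. *)
Lemma divided_difference_Re_pos (k : nat -> Cx) (u z1 z2 : Cx) :
  summ k -> Cnorm u = 1 ->
  (forall z, inD z -> 0 < fst (PS (dco k) z * ((Cone - u * z) * (Cone - u * z)))%cx) ->
  inD z1 -> inD z2 -> z1 <> z2 ->
  0 < fst ((PS k z1 - PS k z2) / (z1 - z2) * ((Cone - u * z1) * (Cone - u * z2)))%cx.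
Proof.
  intros Hk Hu HP H1 H2 H12.
  pose proof (one_sub_neq0 u z1 Hu H1) as N1. pose proof (one_sub_neq0 u z2 Hu H2) as N2.
  pose proof (Csub_neq0 _ _ H12) as N12.
  assert (Uu : fst u * fst u + snd u * snd u = 1) by (rewrite <- Cnorm_sqr, Hu; ring).
  (* The image half-plane: [1 + 2 Re (u w) = (1 - |z|^2) / |1 - u z|^2] for [w = z / (1 - u z)]. *)
  assert (HP' : forall z, inD z -> -1 < 2 * fst (u * (z / (Cone - u * z)))%cx).
  { intros z Hz. pose proof (sqr_sum_neq0 _ (one_sub_neq0 u z Hu Hz)) as Hn.
    pose proof (Cnorm_sqr z) as Nz. pose proof (Cnorm_ge0 z). unfold inD in Hz.
    set (d := fst (Cone - u * z)%cx * fst (Cone - u * z)%cx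
              + snd (Cone - u * z)%cx * snd (Cone - u * z)%cx) in *.
    assert (Hd : 0 < d) by (unfold d in *; nra).
    assert (E : 1 + 2 * fst (u * (z / (Cone - u * z)))%cx
       = (1 - (fst u * fst u + snd u * snd u) * (fst z * fst z + snd z * snd z)) / d).
    { unfold d in *. unfold Cdiv, Cinv. cx_unfold. field. intros X. apply Hn. simpl. lra. }
    rewrite Uu, <- Nz in E.
    assert (0 < (1 - 1 * (Cnorm z * Cnorm z)) / d) by (apply Rdiv_lt_0_compat; nra). lra. }
  pose (w1 := (z1 / (Cone - u * z1))%cx). pose (w2 := (z2 / (Cone - u * z2))%cx).
  assert (Ew : (w1 - w2)%cx = ((z1 - z2) / ((Cone - u * z1) * (Cone - u * z2)))%cx)
    by (unfold w1, w2; field; auto).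
  assert (Nw : (w1 - w2)%cx <> Czero).
  { intros E. apply N12. replace (z1 - z2)%cx
      with ((w1 - w2) * ((Cone - u * z1) * (Cone - u * z2)))%cx by (rewrite Ew; field; auto).
    rewrite E. ring. }
  pose (w := fun x : R => (w2 + RtoC x * (w1 - w2))%cx).
  assert (Hw : forall x, 0 <= x <= 1 -> -1 < 2 * fst (u * w x)%cx).
  { intros x Hx. pose proof (HP' z1 H1) as B1. pose proof (HP' z2 H2) as B2.
    fold w1 in B1. fold w2 in B2.
    replace (fst (u * w x)%cx) with (x * fst (u * w1)%cx + (1 - x) * fst (u * w2)%cx)
      by (unfold w; cx_unfold; ring).
    set (p := fst (u * w1)%cx) in *. set (q := fst (u * w2)%cx) in *.
    assert (0 <= x * (2 * p + 1)) by (apply Rmult_le_pos; lra).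
    assert (0 <= (1 - x) * (2 * q + 1)) by (apply Rmult_le_pos; lra).
    destruct (Rle_lt_dec x 0).
    - assert (x = 0) by lra. subst x. lra.
    - assert (0 < x * (2 * p + 1)) by (apply Rmult_lt_0_compat; lra). lra. }
  assert (Nq : forall x, 0 <= x <= 1 -> (Cone + u * w x)%cx <> Czero).
  { intros x Hx E. specialize (Hw x Hx). assert (E' := f_equal fst E).
    cbn [fst Cadd Cone Czero] in E'. lra. }
  (* The inverse Moebius map along the segment from [w2] to [w1]. It stays in the disk because, for
     [|u| = 1], [|w| < |1 + u w|] is equivalent to [2 Re (u w) > -1]. *)
  pose (z := fun x : R => (w x / (Cone + u * w x))%cx).
  assert (Dz : forall x, 0 <= x <= 1 -> inD (z x)).
  { intros x Hx. unfold inD. specialize (Hw x Hx). pose proof (Cnorm_gt0 _ (Nq x Hx)) as Q.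
    apply Rmult_lt_reg_r with (1 := Q). rewrite <- Cnorm_mul, Rmult_1_l.
    replace (z x * (Cone + u * w x))%cx with (w x) by (unfold z; field; apply Nq, Hx).
    apply Cnorm_lt_sqr; [lra|]. rewrite Cnorm_sqr.
    replace (fst (w x) * fst (w x) + snd (w x) * snd (w x))
      with ((fst u * fst u + snd u * snd u) * (fst (w x) * fst (w x) + snd (w x) * snd (w x)))
      by (rewrite Uu; ring).
    cbn [fst snd Cadd Cmul Cone] in *. nra. }
  assert (Dw : forall x, Cd w x (w1 - w2)%cx).
  { intros x. unfold w. eapply Cd_eq.
    - apply Cd_add; [apply Cd_const|apply Cd_mul; [|apply Cd_const]].
      apply Cd_RtoC. apply is_derive_id_R.
    - cbv beta. change (RtoC 1) with Cone. ring. }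
  (* Since [1 - u z = 1 / (1 + u w)], the derivative of [z] in [w] is [(1 - u z)^2]; division by
     [w1 - w2] removes the direction of the segment. *)
  assert (Dk : forall x, 0 <= x <= 1 -> Cd (fun x => Cinv (w1 - w2) * PS k (z x))%cx x
     (PS (dco k) (z x) * ((Cone - u * z x) * (Cone - u * z x)))%cx).
  { intros x Hx. eapply Cd_eq.
    - apply Cd_scal, Cd_PS; [exact Hk|apply Dz, Hx|]. unfold z.
      apply Cd_div; [apply Nq, Hx|apply Dw|apply Cd_add; [apply Cd_const|apply Cd_scal, Dw]].
    - cbv beta. change (w x / (Cone + u * w x))%cx with (z x).
      set (D := PS (dco k) (z x)). unfold z. specialize (Nq x Hx). field. auto. }
  destruct (MVT_gen (fun x => fst (Cinv (w1 - w2) * PS k (z x))%cx) 0 1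
    (fun x => fst (PS (dco k) (z x) * ((Cone - u * z x) * (Cone - u * z x)))%cx)) as [x [Hx E]].
  - rewrite Rmin_left, Rmax_right by lra. intros x Hx. apply Dk. lra.
  - rewrite Rmin_left, Rmax_right by lra. intros x Hx. apply derivable_continuous_pt.
    eexists. apply is_derive_Reals. apply (proj1 (Dk x Hx)).
  - rewrite Rmin_left, Rmax_right in Hx by lra. specialize (HP (z x) (Dz x Hx)).
    assert (Z1 : z 1 = z1).
    { unfold z, w. replace (w2 + RtoC 1 * (w1 - w2))%cx with w1
        by (change (RtoC 1) with Cone; ring).
      unfold w1. clear - N1. field. split; [exact N1|].
      intros X. apply Cone_neq0. change (R1, R0) with Cone in X. rewrite <- X. ring. }
    assert (Z2 : z 0 = z2).
    { unfold z, w. replace (w2 + RtoC 0 * (w1 - w2))%cx with w2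
        by (change (RtoC 0) with Czero; ring).
      unfold w2. clear - N2. field. split; [exact N2|].
      intros X. apply Cone_neq0. change (R1, R0) with Cone in X. rewrite <- X. ring. }
    rewrite Z1, Z2 in E.
    replace ((PS k z1 - PS k z2) / (z1 - z2) * ((Cone - u * z1) * (Cone - u * z2)))%cx
      with (Cinv (w1 - w2) * PS k z1 - Cinv (w1 - w2) * PS k z2)%cx
      by (rewrite Ew; field; auto).
    change (0 < fst (Cinv (w1 - w2) * PS k z1)%cx - fst (Cinv (w1 - w2) * PS k z2)%cx).
    rewrite E. lra.
Qed.

(** * Level curves of harmonic functions increasing in one variable *)

Lemma second_deriv_min (f f1 : R -> R) (m r l : R) :
  0 < r -> (forall x, Rabs (x - m) < r -> is_derive f x (f1 x)) -> is_derive f1 m l ->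
  (forall x, Rabs (x - m) < r -> f m <= f x) -> 0 <= l.
Proof.
  intros Hr Hf Hl Hm.
  assert (D : forall x, Rabs (x - m) < r -> derivable_pt_lim f x (f1 x))
    by (intros x Hx; apply is_derive_Reals, Hf, Hx).
  assert (Zm : Rabs (m - m) < r) by (rewrite Rminus_diag, Rabs_R0; exact Hr).
  assert (Z : f1 m = 0).
  { pose (pr := exist _ (f1 m) (D m Zm) : derivable_pt f m).
    change (f1 m) with (derive_pt f m pr).
    apply deriv_minimum with (a := m - r) (b := m + r); [lra|lra|].
    intros x H1 H2. apply Hm. apply Rabs_lt_between. lra. }
  destruct (Rle_lt_dec 0 l) as [H|H]; [exact H|exfalso].
  (* With tolerance [- l / 2] the difference quotient of [f1] stays negative near [m]; as
     [f1 m = 0], [f] would decrease just to the right of its minimum. *)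
  apply is_derive_Reals in Hl. destruct (Hl (- l / 2) ltac:(lra)) as [d Hd].
  pose (h := Rmin (r / 2) (d / 2)). pose proof (cond_pos d).
  assert (h0 : 0 < h) by (apply Rmin_pos; lra).
  assert (h1 : h <= r / 2) by apply Rmin_l. assert (h2 : h <= d / 2) by apply Rmin_r.
  destruct (MVT_cor2 f f1 m (m + h) ltac:(lra)) as [x [Ex Hx]].
  { intros y Hy. apply D, Rabs_lt_between. lra. }
  specialize (Hm (m + h)). specialize (Hd (x - m) ltac:(lra)).
  rewrite Rabs_pos_eq in Hd by lra. specialize (Hd ltac:(lra)).
  replace (m + (x - m)) with x in Hd by ring. rewrite Z in Hd.
  apply Rabs_lt_between in Hd.
  assert (f1 x < 0).
  { assert ((f1 x - 0) / (x - m) < 0) by lra.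
    replace (f1 x) with ((f1 x - 0) / (x - m) * (x - m)) by (field; lra). nra. }
  assert (f m <= f (m + h)) by (apply Hm, Rabs_lt_between; lra). nra.
Qed.

(** * Minima on rectangles and a minimum principle *)

(** Extends data on [[a, b]] by constants, so that interval arguments can use functions continuous
    on all of [R]. *)
Definition clamp (a b x : R) : R := Rmax a (Rmin x b).

Lemma clamp_bounds (a b x : R) : a <= b -> a <= clamp a b x <= b.
Proof.
  intros H. unfold clamp. split; [apply Rmax_l|]. apply Rmax_lub; [exact H|apply Rmin_r].
Qed.

Lemma clamp_id (a b x : R) : a <= x <= b -> clamp a b x = x.
Proof. intros H. unfold clamp. rewrite Rmin_left, Rmax_right by lra. reflexivity. Qed.

Lemma clamp_lipschitz (a b x y : R) : Rabs (clamp a b y - clamp a b x) <= Rabs (y - x).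
Proof.
  unfold clamp. unfold Rmin. destruct (Rle_dec x b), (Rle_dec y b); unfold Rmax;
  repeat match goal with |- context [Rle_dec ?p ?q] => destruct (Rle_dec p q) end;
  unfold Rabs; repeat match goal with |- context [Rcase_abs ?p] => destruct (Rcase_abs p) end; lra.
Qed.

Lemma continuity_clamp (a b : R) : continuity (clamp a b).
Proof.
  intros x. apply continuity_pt_locally. intros e. exists e. intros y Hy.
  eapply Rle_lt_trans; [apply clamp_lipschitz|exact Hy].
Qed.

(** Minimise in [y] for each [x], then in [x]. The minimum over [y] depends continuously on [x] by
    uniform continuity, although the chosen minimiser [Y x] need not. *)
Lemma rectangle_min (u : R -> R -> R) (a b c d : R) :
  a <= b -> c <= d ->
  (forall x y, a <= x <= b -> c <= y <= d -> continuity_2d_pt u x y) ->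
  exists x0 y0, a <= x0 <= b /\ c <= y0 <= d /\
    forall x y, a <= x <= b -> c <= y <= d -> u x0 y0 <= u x y.
Proof.
  intros Hab Hcd Hu.
  pose proof (fun x => clamp_bounds a b x Hab) as Hcl.
  assert (Hy : forall x, exists y0, c <= y0 <= d /\
     forall y, c <= y <= d -> u (clamp a b x) y0 <= u (clamp a b x) y).
  { intros x. destruct (continuity_ab_min (u (clamp a b x)) c d Hcd) as [y0 [H1 H2]].
    - intros y Hy. apply continuity_pt_locally. intros e.
      destruct (Hu _ y (Hcl x) Hy e) as [dl Hdl]. exists dl. intros y' Hy'.
      apply Hdl; [rewrite Rminus_diag, Rabs_R0; apply cond_pos|exact Hy'].
    - exists y0. auto. }
  pose (Y := fun x => proj1_sig (constructive_indefinite_description _ (Hy x))).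
  assert (HY : forall x, c <= Y x <= d /\
     forall y, c <= y <= d -> u (clamp a b x) (Y x) <= u (clamp a b x) y)
    by (intros x; exact (proj2_sig (constructive_indefinite_description _ (Hy x)))).
  destruct (continuity_ab_min (fun x => u (clamp a b x) (Y x)) a b Hab) as [x0 [H1 H2]].
  - intros x Hx. apply continuity_pt_locally. intros e.
    assert (He : 0 < e / 2) by (pose proof (cond_pos e); lra).
    destruct (uniform_continuity_2d u a b c d Hu (mkposreal _ He)) as [dl Hdl].
    exists dl. intros x' Hx'. change (Rabs (x' - x) < dl) in Hx'.
    destruct (HY x) as [Y1 Y2]. destruct (HY x') as [Y1' Y2'].
    assert (B : forall y, c <= y <= d ->
       Rabs (u (clamp a b x') y - u (clamp a b x) y) < e / 2).
    { intros y Hy'. apply Hdl; auto.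
      - eapply Rle_lt_trans; [apply clamp_lipschitz|exact Hx'].
      - rewrite Rminus_diag, Rabs_R0. apply cond_pos. }
    assert (B1 := B _ Y1). assert (B2 := B _ Y1').
    specialize (Y2 _ Y1'). specialize (Y2' _ Y1).
    apply Rabs_lt_between in B1, B2. apply Rabs_lt_between. lra.
  - exists x0, (Y x0). split; [exact H2|]. split; [apply HY|]. intros x y Hx Hy'.
    specialize (H1 x Hx). rewrite (clamp_id a b x0 H2), (clamp_id a b x Hx) in H1.
    eapply Rle_trans; [exact H1|]. destruct (HY x) as [_ K]. rewrite (clamp_id a b x Hx) in K. auto.
Qed.

(** At an interior minimum both second derivatives would be non-negative, against the strict sign of
    their sum; so the minimum lies on the boundary. *)
Lemma superharmonic_min_principle (u us uss ut utt : R -> R -> R) (a b c d m : R) :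
  a <= b -> c <= d ->
  (forall x y, a <= x <= b -> c <= y <= d -> continuity_2d_pt u x y) ->
  (forall x y, a < x < b -> c < y < d ->
     is_derive (fun x => u x y) x (us x y) /\ is_derive (fun x => us x y) x (uss x y) /\
     is_derive (u x) y (ut x y) /\ is_derive (ut x) y (utt x y) /\ uss x y + utt x y < 0) ->
  (forall y, c <= y <= d -> m <= u a y /\ m <= u b y) ->
  (forall x, a <= x <= b -> m <= u x c /\ m <= u x d) ->
  forall x y, a <= x <= b -> c <= y <= d -> m <= u x y.
Proof.
  intros Hab Hcd Hc Hd Hs Ht x y Hx Hy.
  destruct (rectangle_min u a b c d Hab Hcd Hc) as [x0 [y0 [Hx0 [Hy0 Hmin]]]].
  apply Rle_trans with (u x0 y0); [|auto].
  destruct (Req_dec x0 a) as [->|N1]; [apply Hs, Hy0|].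
  destruct (Req_dec x0 b) as [->|N2]; [apply Hs, Hy0|].
  destruct (Req_dec y0 c) as [->|N3]; [apply Ht, Hx0|].
  destruct (Req_dec y0 d) as [->|N4]; [apply Ht, Hx0|].
  exfalso.
  pose (r := Rmin (Rmin (x0 - a) (b - x0)) (Rmin (y0 - c) (d - y0))).
  assert (Hr : 0 < r) by (repeat apply Rmin_pos; lra).
  assert (r1 : r <= x0 - a) by (eapply Rle_trans; [apply Rmin_l|apply Rmin_l]).
  assert (r2 : r <= b - x0) by (eapply Rle_trans; [apply Rmin_l|apply Rmin_r]).
  assert (r3 : r <= y0 - c) by (eapply Rle_trans; [apply Rmin_r|apply Rmin_l]).
  assert (r4 : r <= d - y0) by (eapply Rle_trans; [apply Rmin_r|apply Rmin_r]).
  assert (P1 : 0 <= uss x0 y0).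
  { apply second_deriv_min with (f := fun x => u x y0) (f1 := fun x => us x y0) (m := x0) (r := r);
      try assumption.
    - intros z Hz. apply Rabs_lt_between in Hz. apply Hd; lra.
    - apply Hd; lra.
    - intros z Hz. apply Rabs_lt_between in Hz. apply Hmin; lra. }
  assert (P2 : 0 <= utt x0 y0).
  { apply second_deriv_min with (f := u x0) (f1 := ut x0) (m := y0) (r := r); try assumption.
    - intros z Hz. apply Rabs_lt_between in Hz. apply Hd; lra.
    - apply Hd; lra.
    - intros z Hz. apply Rabs_lt_between in Hz. apply Hmin; lra. }
  destruct (Hd x0 y0 ltac:(lra) ltac:(lra)) as [_ [_ [_ [_ Hneg]]]]. lra.
Qed.

(** * Harmonic functions on a strip and their level sets *)

(** The derivatives are explicit functions, so harmonicity concerns two separate second derivatives.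
    Joint continuity of [V] is included because minimising over rectangles requires it. *)
Definition increasing_harmonic (lo hi : R) (V Vs Vss Vt Vtt : R -> R -> R) : Prop :=
  forall s t, lo < s < hi ->
    continuity_2d_pt V s t /\
    is_derive (fun x => V x t) s (Vs s t) /\ is_derive (fun x => Vs x t) s (Vss s t) /\
    is_derive (V s) t (Vt s t) /\ is_derive (Vt s) t (Vtt s t) /\
    Vss s t + Vtt s t = 0 /\ 0 < Vt s t.

Lemma increasing_harmonic_lt (lo hi : R) (V Vs Vss Vt Vtt : R -> R -> R) (s t t' : R) :
  increasing_harmonic lo hi V Vs Vss Vt Vtt -> lo < s < hi -> t < t' -> V s t < V s t'.
Proof.
  intros HV Hs Ht.
  destruct (MVT_cor2 (V s) (Vt s) t t' Ht) as [x [Ex Hx]].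
  { intros x _. apply is_derive_Reals. apply HV, Hs. }
  assert (0 < Vt s x) by (apply HV, Hs). nra.
Qed.

(** Changing the signs of [t] and [V] together preserves monotonicity; it turns statements about
    values above [c] into statements about values below. *)
Lemma increasing_harmonic_flip (lo hi : R) (V Vs Vss Vt Vtt : R -> R -> R) :
  increasing_harmonic lo hi V Vs Vss Vt Vtt ->
  increasing_harmonic lo hi (fun s t => - V s (- t)) (fun s t => - Vs s (- t))
    (fun s t => - Vss s (- t)) (fun s t => Vt s (- t)) (fun s t => - Vtt s (- t)).
Proof.
  intros HV s t Hs. destruct (HV s (- t) Hs) as [Hc [H1 [H2 [H3 [H4 [H5 H6]]]]]].
  assert (Dn : forall x, is_derive Ropp x (-1)).
  { intros x. apply (is_derive_eq _ _ (- (1))); [|ring]. apply is_derive_opp_R, is_derive_id_R. }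
  refine (conj _ (conj _ (conj _ (conj _ (conj _ (conj _ _)))))).
  - intros e. destruct (Hc e) as [d Hd]. exists d. intros x y Hx Hy.
    replace (- V x (- y) - - V s (- t)) with (- (V x (- y) - V s (- t))) by ring.
    rewrite Rabs_Ropp. apply Hd; [exact Hx|].
    replace (- y - - t) with (- (y - t)) by ring. rewrite Rabs_Ropp. exact Hy.
  - apply is_derive_opp_R, H1.
  - apply is_derive_opp_R, H2.
  - eapply is_derive_eq; [apply is_derive_opp_R, (is_derive_comp_R (V s) Ropp t _ _ H3 (Dn t))|]. ring.
  - eapply is_derive_eq; [exact (is_derive_comp_R (Vt s) Ropp t _ _ H4 (Dn t))|]. ring.
  - lra.
  - exact H6.
Qed.

(* [V] dominates [c' > c] on two long vertical sides and is bounded below; a barrier whose weight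
   on the far horizontal sides tends to 0 at the centre forces [V] above [c] there. *)
Lemma increasing_harmonic_above (lo hi : R) (V Vs Vss Vt Vtt : R -> R -> R) (s1 s s2 t1 t2 c : R) :
  increasing_harmonic lo hi V Vs Vss Vt Vtt ->
  lo < s1 -> s1 < s -> s < s2 -> s2 < hi -> V s1 t1 = c -> V s2 t2 = c ->
  exists t, c < V s t.
Proof.
  intros HV L1 L2 L3 L4 E1 E2.
  pose proof (fun s t t' => increasing_harmonic_lt lo hi V Vs Vss Vt Vtt s t t' HV) as Inc.
  (* A height above both base points: from [t0] upwards [V] is at least [c'] on both vertical
     sides. *)
  pose (t0 := Rmax t1 t2 + 1). pose (c' := Rmin (V s1 t0) (V s2 t0)).
  pose proof (Rmax_l t1 t2). pose proof (Rmax_r t1 t2).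
  assert (Hc' : c < c').
  { apply Rmin_glb_lt; [rewrite <- E1|rewrite <- E2]; apply Inc; unfold t0; lra. }
  destruct (continuity_ab_min (fun x => V x t0) s1 s2 ltac:(lra)) as [x0 [Hx0 _]].
  { intros x Hx. apply derivable_continuous_pt. exists (Vs x t0).
    apply is_derive_Reals. apply HV. lra. }
  (* By monotonicity [V x0 t0] bounds [V] from below above height [t0]; adding [K] lifts this bound
     past [c']. *)
  pose (K := Rabs (c' - V x0 t0) + 1). pose proof (Rle_abs (c' - V x0 t0)).
  assert (HK : 0 < K) by (unfold K; pose proof (Rabs_pos (c' - V x0 t0)); lra).
  (* [L] is chosen for the closing estimate [2 K W^2 / L^2 < c' - c]: its left numerator is
     [(L - 1) (c' - c)], and [L - 1 < L^2]. *)
  pose (W := s2 - s1). pose (L := 2 * K * (W * W) / (c' - c) + 1).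
  assert (HW : 0 < W) by (unfold W; lra).
  assert (HL : 1 <= L).
  { unfold L. assert (0 <= 2 * K * (W * W) / (c' - c)); [|lra].
    apply Rdiv_le_0_compat; [|lra]. apply Rmult_le_pos; nra. }
  pose (T := t0 + L). pose (e := K / (L * L)).
  assert (He : 0 < e) by (apply Rdiv_lt_0_compat; nra).
  assert (EL : e * (L * L) = K) by (unfold e; field; lra).
  (* The barrier has Laplacian [2 e - 4 e < 0]. On the rectangle it is non-negative, at least
     [e L^2 = K] on the horizontal sides, and at most [2 W^2 e] at the middle height [T]. *)
  pose (b := fun x y => e * ((y - T) * (y - T) + 2 * (W * W - (x - s1) * (x - s1)))).
  assert (Hb : forall x y, s1 <= x <= s2 -> e * ((y - T) * (y - T)) <= b x y).
  { intros x y Hx. unfold b. apply Rmult_le_compat_l; [lra|].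
    assert ((x - s1) * (x - s1) <= W * W) by (unfold W; nra). lra. }
  assert (Hb0 : forall x y, s1 <= x <= s2 -> 0 <= b x y).
  { intros x y Hx. eapply Rle_trans; [|apply Hb, Hx]. apply Rmult_le_pos; [lra|]. apply Rle_0_sqr. }
  assert (Mono : forall x y, lo < x < hi -> t0 <= y -> V x t0 <= V x y).
  { intros x y Hx Hy. destruct (Req_dec t0 y) as [->|N]; [lra|]. left. apply Inc; lra. }
  exists T.
  assert (G : c' <= V s T + b s T).
  { apply (superharmonic_min_principle (fun x y => V x y + b x y)
      (fun x y => Vs x y + e * (- (4 * (x - s1)))) (fun x y => Vss x y + e * (-4))
      (fun x y => Vt x y + e * (2 * (y - T))) (fun x y => Vtt x y + e * 2)
      s1 s2 (T - L) (T + L)); try lra.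
    - intros x y Hx Hy. destruct (HV x y ltac:(lra)) as [Hc _].
      apply continuity_2d_pt_plus; [exact Hc|].
      apply continuity_2d_pt_mult; [apply continuity_2d_pt_const|].
      apply continuity_2d_pt_plus.
      + apply continuity_2d_pt_mult; (apply continuity_2d_pt_minus;
          [apply continuity_2d_pt_id2|apply continuity_2d_pt_const]).
      + apply continuity_2d_pt_mult; [apply continuity_2d_pt_const|].
        apply continuity_2d_pt_minus; [apply continuity_2d_pt_const|].
        apply continuity_2d_pt_mult; (apply continuity_2d_pt_minus;
          [apply continuity_2d_pt_id1|apply continuity_2d_pt_const]).
    - intros x y Hx Hy. destruct (HV x y ltac:(lra)) as [_ [D1 [D2 [D3 [D4 [D5 _]]]]]].
      refine (conj _ (conj _ (conj _ (conj _ _)))).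
      + apply is_derive_add_R; [exact D1|]. unfold b. auto_derive; [trivial|ring].
      + apply is_derive_add_R; [exact D2|]. auto_derive; [trivial|ring].
      + apply is_derive_add_R; [exact D3|]. unfold b. auto_derive; [trivial|ring].
      + apply is_derive_add_R; [exact D4|]. auto_derive; [trivial|ring].
      + nra.
    - intros y Hy. pose proof (Hb0 s1 y ltac:(lra)). pose proof (Hb0 s2 y ltac:(lra)).
      pose proof (Mono s1 y ltac:(lra) ltac:(unfold T in *; lra)).
      pose proof (Mono s2 y ltac:(lra) ltac:(unfold T in *; lra)).
      pose proof (Rmin_l (V s1 t0) (V s2 t0) : c' <= _).
      pose proof (Rmin_r (V s1 t0) (V s2 t0) : c' <= _). lra.
    - intros x Hx. specialize (Hx0 x Hx).
      pose proof (Hb x (T - L) Hx) as B1. pose proof (Hb x (T + L) Hx) as B2.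
      replace ((T - L - T) * (T - L - T)) with (L * L) in B1 by ring.
      replace ((T + L - T) * (T + L - T)) with (L * L) in B2 by ring.
      pose proof (Mono x (T - L) ltac:(lra) ltac:(unfold T in *; lra)).
      pose proof (Mono x (T + L) ltac:(lra) ltac:(unfold T in *; lra)).
      unfold K in *. lra. }
  assert (Bs : b s T <= 2 * (W * W) * e).
  { assert (0 <= e * ((s - s1) * (s - s1))) by (apply Rmult_le_pos; [lra|apply Rle_0_sqr]).
    unfold b. lra. }
  assert (2 * (W * W) * e < c' - c); [|lra].
  unfold e. replace (2 * (W * W) * (K / (L * L))) with (2 * K * (W * W) / (L * L)) by (field; lra).
  apply Rlt_div_l; [nra|].
  assert (EQ : 2 * K * (W * W) = (L - 1) * (c' - c)) by (unfold L; field; lra).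
  rewrite EQ. assert (0 < (c' - c) * (L * L - L + 1)) by (apply Rmult_lt_0_compat; nra). lra.
Qed.

(** The preceding lemma, applied to [V] and to its flip, gives values above and below [c] at the
    abscissa [s]; the intermediate value theorem finishes. *)
Lemma increasing_harmonic_level (lo hi : R) (V Vs Vss Vt Vtt : R -> R -> R) (s1 s s2 t1 t2 c : R) :
  increasing_harmonic lo hi V Vs Vss Vt Vtt ->
  lo < s1 -> s1 <= s <= s2 -> s2 < hi -> V s1 t1 = c -> V s2 t2 = c ->
  exists t, V s t = c.
Proof.
  intros HV L1 L2 L4 E1 E2.
  destruct (Req_dec s s1) as [->|N1]; [eauto|]. destruct (Req_dec s s2) as [->|N2]; [eauto|].
  destruct (increasing_harmonic_above lo hi V Vs Vss Vt Vtt s1 s s2 t1 t2 c HV) as [ta Ha]; try lra.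
  destruct (increasing_harmonic_above lo hi _ _ _ _ _ s1 s s2 (- t1) (- t2) (- c)
    (increasing_harmonic_flip _ _ _ _ _ _ _ HV)) as [tb Hb]; try lra;
    try (rewrite Ropp_involutive; lra).
  destruct (IVT_gen (V s) (- tb) ta c) as [t [_ Ht]].
  - intros t. apply derivable_continuous_pt. exists (Vt s t). apply is_derive_Reals. apply HV. lra.
  - rewrite Rmin_left, Rmax_right by lra. lra.
  - eauto.
Qed.

(** The heights [g x] come from a choice, yet are continuous: [V] is below [c] at [g x - e] and
    above [c] at [g x + e], both signs persist for nearby abscissae, and monotonicity traps [g] in
    between. *)
Lemma increasing_harmonic_level_curve (lo hi : R) (V Vs Vss Vt Vtt : R -> R -> R)
    (s1 s2 t1 t2 c : R) :
  increasing_harmonic lo hi V Vs Vss Vt Vtt ->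
  lo < s1 -> s1 <= s2 -> s2 < hi -> V s1 t1 = c -> V s2 t2 = c ->
  exists g, continuity g /\ forall x, V (clamp s1 s2 x) (g x) = c.
Proof.
  intros HV L1 L2 L3 E1 E2.
  pose proof (fun s t t' => increasing_harmonic_lt lo hi V Vs Vss Vt Vtt s t t' HV) as Inc.
  assert (Hb : forall x, lo < clamp s1 s2 x < hi).
  { intros x. pose proof (clamp_bounds s1 s2 x L2). lra. }
  assert (Hex : forall x, exists t, V (clamp s1 s2 x) t = c).
  { intros x. apply (increasing_harmonic_level lo hi V Vs Vss Vt Vtt s1 _ s2 t1 t2 c HV);
    auto using clamp_bounds. }
  pose (g := fun x => proj1_sig (constructive_indefinite_description _ (Hex x))).
  assert (Hg : forall x, V (clamp s1 s2 x) (g x) = c)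
    by (intros x; exact (proj2_sig (constructive_indefinite_description _ (Hex x)))).
  exists g. split; [|exact Hg]. intros x. apply continuity_pt_locally. intros e.
  assert (Hloc : forall t, continuity_pt (fun x => V (clamp s1 s2 x) t) x).
  { intros t. apply (continuity_pt_comp (clamp s1 s2) (fun s => V s t)); [apply continuity_clamp|].
    apply derivable_continuous_pt. exists (Vs (clamp s1 s2 x) t). apply is_derive_Reals.
    exact (proj1 (proj2 (HV _ t (Hb x)))). }
  pose proof (cond_pos e).
  assert (A1 := Inc (clamp s1 s2 x) (g x - e) (g x) (Hb x) ltac:(lra)).
  assert (A2 := Inc (clamp s1 s2 x) (g x) (g x + e) (Hb x) ltac:(lra)).
  rewrite Hg in A1, A2.
  assert (P1 : 0 < c - V (clamp s1 s2 x) (g x - e)) by lra.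
  assert (P2 : 0 < V (clamp s1 s2 x) (g x + e) - c) by lra.
  generalize (proj1 (continuity_pt_locally _ _) (Hloc (g x - e)) (mkposreal _ P1)).
  generalize (proj1 (continuity_pt_locally _ _) (Hloc (g x + e)) (mkposreal _ P2)).
  intros Q2 Q1. generalize (filter_and _ _ Q1 Q2). apply filter_imp. simpl. intros y [B1 B2].
  apply Rabs_lt_between in B1, B2. apply Rabs_lt_between.
  assert (C1 : V (clamp s1 s2 y) (g x - e) < c) by lra.
  assert (C2 : c < V (clamp s1 s2 y) (g x + e)) by lra.
  specialize (Hg y). split.
  - destruct (Rlt_le_dec (- e) (g y - g x)) as [K|K]; [exact K|exfalso].
    destruct (Req_dec (g y) (g x - e)) as [E|N]; [rewrite E in Hg; lra|].
    assert (V (clamp s1 s2 y) (g y) < V (clamp s1 s2 y) (g x - e)) by (apply Inc; auto; lra). lra.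
  - destruct (Rlt_le_dec (g y - g x) e) as [K|K]; [exact K|exfalso].
    destruct (Req_dec (g y) (g x + e)) as [E|N]; [rewrite E in Hg; lra|].
    assert (V (clamp s1 s2 y) (g x + e) < V (clamp s1 s2 y) (g y)) by (apply Inc; auto; lra). lra.
Qed.

(** * Continuous, locally injective functions on an interval *)

Definition locally_injective_on (X : R -> R) (a b : R) : Prop :=
  forall m, a <= m <= b -> exists r, 0 < r /\ forall x y, a <= x <= b -> a <= y <= b ->
    Rabs (x - m) < r -> Rabs (y - m) < r -> X x = X y -> x = y.

(** Near a maximum, the larger of the two values at [m - h] and [m + h] is also attained on the
    other side of [m], by the intermediate value theorem. *)
Lemma no_interior_max (X : R -> R) (a b m : R) :
  continuity X -> locally_injective_on X a b -> a < m < b ->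
  ~ (forall x, a <= x <= b -> X x <= X m).
Proof.
  intros Hc Hi Hm Hmax. destruct (Hi m ltac:(lra)) as [r [Hr H]].
  pose (h := Rmin (r / 2) (Rmin (m - a) (b - m))).
  assert (h0 : 0 < h) by (repeat apply Rmin_pos; lra).
  assert (h1 : h <= r / 2) by apply Rmin_l.
  assert (h2 : h <= m - a) by (eapply Rle_trans; [apply Rmin_r|apply Rmin_l]).
  assert (h3 : h <= b - m) by (eapply Rle_trans; [apply Rmin_r|apply Rmin_r]).
  assert (M1 := Hmax (m - h) ltac:(lra)). assert (M2 := Hmax (m + h) ltac:(lra)).
  destruct (Rle_lt_dec (X (m - h)) (X (m + h))) as [D|D].
  - destruct (IVT_gen X (m - h) m (X (m + h)) Hc) as [x [Hx Ex]].
    { rewrite Rmin_left, Rmax_right by lra. lra. }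
    rewrite Rmin_left, Rmax_right in Hx by lra.
    assert (x = m + h); [|lra].
    apply H; try (apply Rabs_lt_between); try lra; exact Ex.
  - destruct (IVT_gen X m (m + h) (X (m - h)) Hc) as [x [Hx Ex]].
    { rewrite Rmin_right, Rmax_left by lra. lra. }
    rewrite Rmin_left, Rmax_right in Hx by lra.
    assert (x = m - h); [|lra].
    apply H; try (apply Rabs_lt_between); try lra; exact Ex.
Qed.

(** With equal end values, maximum and minimum can only sit at the ends, so the function would be
    constant. *)
Lemma locally_injective_endpoints (X : R -> R) (a b : R) :
  continuity X -> a < b -> locally_injective_on X a b -> X a <> X b.
Proof.
  intros Hc Hab Hi E.
  assert (Hmax : exists M, a <= M <= b /\ forall x, a <= x <= b -> X x <= X M).
  { destruct (continuity_ab_maj X a b ltac:(lra)) as [M [H1 H2]]; [intros; apply Hc|eauto]. }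
  assert (Hmin : exists m, a <= m <= b /\ forall x, a <= x <= b -> X m <= X x).
  { destruct (continuity_ab_min X a b ltac:(lra)) as [M [H1 H2]]; [intros; apply Hc|eauto]. }
  destruct Hmax as [M [HM1 HM2]]. destruct Hmin as [m [Hm1 Hm2]].
  assert (EM : X M = X a).
  { destruct (Req_dec M a) as [->|N1]; [reflexivity|]. destruct (Req_dec M b) as [->|N2]; [auto|].
    exfalso. apply (no_interior_max X a b M Hc Hi); [lra|exact HM2]. }
  assert (Em : X m = X a).
  { destruct (Req_dec m a) as [->|N1]; [reflexivity|]. destruct (Req_dec m b) as [->|N2]; [auto|].
    exfalso. apply (no_interior_max (fun x => - X x) a b m); [..|lra|].
    - apply (continuity_opp X Hc).
    - intros y Hy. destruct (Hi y Hy) as [r [Hr H]]. exists r. split; [exact Hr|].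
      intros x1 x2 A1 A2 A3 A4 A5. apply H; auto. lra.
    - intros x Hx. specialize (Hm2 x Hx). lra. }
  destruct (Hi a ltac:(lra)) as [r [Hr H]].
  pose (h := Rmin (r / 2) (b - a)).
  assert (h0 : 0 < h) by (apply Rmin_pos; lra).
  assert (h1 : h <= r / 2) by apply Rmin_l. assert (h2 : h <= b - a) by apply Rmin_r.
  specialize (HM2 (a + h) ltac:(lra)). specialize (Hm2 (a + h) ltac:(lra)).
  assert (a = a + h); [|lra].
  apply H; try (apply Rabs_lt_between); lra.
Qed.

(** * The disk as a vertical strip *)

(** Over an arbitrary [UniformSpace], so that the same rules serve the [(s, t)] plane and curves
    parametrised by [R]. *)
Definition Ccont {U : UniformSpace} (p : U -> Cx) (x : U) : Prop :=
  continuous (fun y => fst (p y)) x /\ continuous (fun y => snd (p y)) x.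

Lemma continuous_add_R {U : UniformSpace} (f g : U -> R) (x : U) :
  continuous f x -> continuous g x -> continuous (fun y => f y + g y) x.
Proof. exact (continuous_plus (K := R_AbsRing) (V := R_NormedModule) f g x). Qed.

Lemma continuous_opp_R {U : UniformSpace} (f : U -> R) (x : U) :
  continuous f x -> continuous (fun y => - f y) x.
Proof. exact (continuous_opp (K := R_AbsRing) (V := R_NormedModule) f x). Qed.

Lemma continuous_mul_R {U : UniformSpace} (f g : U -> R) (x : U) :
  continuous f x -> continuous g x -> continuous (fun y => f y * g y) x.
Proof. exact (continuous_mult (K := R_AbsRing) f g x). Qed.

Lemma continuous_derivable_comp {U : UniformSpace} (h h' : R -> R) (f : U -> R) (x : U) :
  is_derive h (f x) (h' (f x)) -> continuous f x -> continuous (fun y => h (f y)) x.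
Proof.
  intros Hh Hf. apply (continuous_comp f h); [exact Hf|].
  apply (ex_derive_continuous (K := R_AbsRing) (V := R_NormedModule)). eexists. exact Hh.
Qed.

Lemma Ccont_const {U : UniformSpace} (c : Cx) (x : U) : Ccont (fun _ => c) x.
Proof. split; apply continuous_const. Qed.

Lemma Ccont_add {U : UniformSpace} (p q : U -> Cx) (x : U) :
  Ccont p x -> Ccont q x -> Ccont (fun y => p y + q y)%cx x.
Proof. intros [H1 H2] [K1 K2]. split; apply continuous_add_R; assumption. Qed.

Lemma Ccont_mul {U : UniformSpace} (p q : U -> Cx) (x : U) :
  Ccont p x -> Ccont q x -> Ccont (fun y => p y * q y)%cx x.
Proof.
  intros [H1 H2] [K1 K2].
  split; (apply continuous_add_R; [|try apply continuous_opp_R]; apply continuous_mul_R; assumption).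
Qed.

Lemma Ccont_sub {U : UniformSpace} (p q : U -> Cx) (x : U) :
  Ccont p x -> Ccont q x -> Ccont (fun y => p y - q y)%cx x.
Proof.
  intros H [K1 K2]. apply Ccont_add; [exact H|]. split; apply continuous_opp_R; assumption.
Qed.

Lemma Ccont_inv {U : UniformSpace} (p : U -> Cx) (x : U) :
  p x <> Czero -> Ccont p x -> Ccont (fun y => Cinv (p y)) x.
Proof.
  intros Hn [H1 H2]. pose proof (sqr_sum_neq0 _ Hn) as Hd.
  assert (HI : continuous (fun y => / (fst (p y) * fst (p y) + snd (p y) * snd (p y))) x).
  { apply (continuous_comp (fun y => fst (p y) * fst (p y) + snd (p y) * snd (p y)) Rinv).
    - apply continuous_add_R; apply continuous_mul_R; assumption.
    - apply continuous_Rinv. exact Hd. }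
  split; apply continuous_mul_R; try assumption. apply continuous_opp_R. assumption.
Qed.

Lemma Ccont_div {U : UniformSpace} (p q : U -> Cx) (x : U) :
  q x <> Czero -> Ccont p x -> Ccont q x -> Ccont (fun y => p y / q y)%cx x.
Proof. intros Hn Hp Hq. apply Ccont_mul; [exact Hp|]. apply Ccont_inv; assumption. Qed.

Lemma Ccont_norm {U : UniformSpace} (p : U -> Cx) (x : U) :
  Ccont p x -> forall e, 0 < e -> locally x (fun y => Cnorm (p y - p x)%cx < e).
Proof.
  intros [H1 H2] e He. assert (He2 : 0 < e / 2) by lra.
  generalize (proj1 (filterlim_locally _ _) H1 (mkposreal _ He2)).
  generalize (proj1 (filterlim_locally _ _) H2 (mkposreal _ He2)).
  intros Q2 Q1. generalize (filter_and _ _ Q1 Q2). apply filter_imp. intros y [B1 B2].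
  change (Rabs (fst (p y) - fst (p x)) < e / 2) in B1.
  change (Rabs (snd (p y) - snd (p x)) < e / 2) in B2.
  eapply Rle_lt_trans; [apply Cnorm_le_sum|].
  change (Rabs (fst (p y) - fst (p x)) + Rabs (snd (p y) - snd (p x)) < e). lra.
Qed.

Lemma norm_Ccont {U : UniformSpace} (p : U -> Cx) (x : U) :
  (forall e, 0 < e -> locally x (fun y => Cnorm (p y - p x)%cx < e)) -> Ccont p x.
Proof.
  intros H. split; apply filterlim_locally; intros e; generalize (H e (cond_pos e));
  apply filter_imp; intros y Hy.
  - change (Rabs (fst (p y - p x)%cx) < e). eapply Rle_lt_trans; [apply Cnorm_fst|exact Hy].
  - change (Rabs (snd (p y - p x)%cx) < e). eapply Rle_lt_trans; [apply Cnorm_snd|exact Hy].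
Qed.

Definition continuous_D (F : Cx -> Cx) : Prop :=
  forall z, inD z -> forall e, 0 < e -> exists d, 0 < d /\
    forall w, inD w -> Cnorm (w - z)%cx < d -> Cnorm (F w - F z)%cx < e.

Lemma Ccont_comp_D {U : UniformSpace} (F : Cx -> Cx) (p : U -> Cx) (x : U) :
  continuous_D F -> (forall y, inD (p y)) -> Ccont p x -> Ccont (fun y => F (p y)) x.
Proof.
  intros HF HD Hp. apply norm_Ccont. intros e He. destruct (HF _ (HD x) e He) as [d [Hd H]].
  generalize (Ccont_norm p x Hp d Hd). apply filter_imp. intros y Hy. apply H; auto.
Qed.

Lemma Ccont_PS {U : UniformSpace} (a : nat -> Cx) (p : U -> Cx) (x : U) :
  summ a -> inD (p x) -> Ccont p x -> Ccont (fun y => PS a (p y)) x.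
Proof.
  intros Ha HD Hp. apply norm_Ccont. intros e He.
  destruct (PS_continuous a _ Ha HD e He) as [d [Hd H]].
  generalize (Ccont_norm p x Hp d Hd). apply filter_imp. intros y Hy. apply H. exact Hy.
Qed.

(** * Coordinates on the disk *)

(** The exponential of [- t + i s]. The minus sign is what makes [V] increase, rather than decrease,
    with [t]. *)
Definition polar (s t : R) : Cx := (RtoC (exp (- t)) * Cexpi s)%cx.
Definition strip_den (bet : R) (E : Cx) : Cx := (Cexpi bet - Cexpi (- bet) * E)%cx.
(* Inverse of [zeta |-> (1 + e^{i bet} zeta) / (1 + e^{-i bet} zeta)]. *)
Definition strip_map (bet : R) (E : Cx) : Cx := ((E - Cone) / strip_den bet E)%cx.

(** Compares denominator and numerator of [strip_map]. A positive gap yields at once that the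
    denominator does not vanish and that the quotient lies in the disk. *)
Lemma polar_strip_gap (bet s t : R) :
  let N := strip_den bet (polar s t) in let M := (polar s t - Cone)%cx in
  fst N * fst N + snd N * snd N
  = fst M * fst M + snd M * snd M + 4 * exp (- t) * sin bet * sin (bet - s).
Proof.
  unfold strip_den, polar, Cexpi. cx_unfold. rewrite cos_neg, sin_neg, sin_minus.
  pose proof (sin2_cos2 bet) as P. unfold Rsqr in P.
  set (c := cos bet) in *. set (d := sin bet) in *. set (x := cos s). set (y := sin s).
  set (r := exp (- t)).
  (* The two sides differ by a multiple of [sin^2 + cos^2 - 1], made explicit for [ring]. *)
  match goal with |- ?L = ?Q =>
    assert (L = Q + (d * d + c * c - 1) * (1 + r * r * (x * x + y * y) - 2 * r * x)) as -> by ring end.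
  rewrite P. ring.
Qed.

Lemma strip_gap_pos (bet s t : R) : 0 < bet < PI -> bet - PI < s < bet ->
  0 < 4 * exp (- t) * sin bet * sin (bet - s).
Proof.
  intros Hb Hs. pose proof (exp_pos (- t)).
  assert (0 < sin bet) by (apply sin_gt_0; lra).
  assert (0 < sin (bet - s)) by (apply sin_gt_0; lra).
  repeat apply Rmult_lt_0_compat; lra.
Qed.

Lemma strip_den_neq0 (bet s t : R) : 0 < bet < PI -> bet - PI < s < bet ->
  strip_den bet (polar s t) <> Czero.
Proof.
  intros Hb Hs E. pose proof (polar_strip_gap bet s t) as G. cbv zeta in G.
  rewrite E in G. cbn [fst snd Czero] in G.
  pose proof (strip_gap_pos bet s t Hb Hs). nra.
Qed.

Lemma strip_map_inD (bet s t : R) : 0 < bet < PI -> bet - PI < s < bet ->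
  inD (strip_map bet (polar s t)).
Proof.
  intros Hb Hs. pose proof (strip_den_neq0 bet s t Hb Hs) as Hn.
  pose proof (polar_strip_gap bet s t) as G. cbv zeta in G.
  pose proof (strip_gap_pos bet s t Hb Hs). pose proof (Cnorm_gt0 _ Hn) as HN.
  unfold inD. apply Rmult_lt_reg_r with (1 := HN). rewrite <- Cnorm_mul, Rmult_1_l.
  replace (strip_map bet (polar s t) * strip_den bet (polar s t))%cx with (polar s t - Cone)%cx
    by (unfold strip_map; field; exact Hn).
  apply Cnorm_lt_sqr; [lra|]. rewrite Cnorm_sqr. lra.
Qed.

Lemma Cexpi_diff (bet : R) : (Cexpi bet - Cexpi (- bet))%cx = (0, 2 * sin bet).
Proof.
  unfold Cexpi. cx_unfold. rewrite cos_neg, sin_neg. f_equal; ring.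
Qed.

Lemma Cexpi_diff_neq0 (bet : R) : 0 < bet < PI -> (Cexpi bet - Cexpi (- bet))%cx <> Czero.
Proof.
  intros Hb. rewrite Cexpi_diff. intros E. injection E. pose proof (sin_gt_0 bet). lra.
Qed.

Lemma sin_eq0_small (x : R) : - PI < x < PI -> sin x = 0 -> x = 0.
Proof.
  intros Hx E. destruct (Rtotal_order x 0) as [H|[H|H]]; [|exact H|].
  - pose proof (sin_gt_0 (- x) ltac:(lra) ltac:(lra)) as P. rewrite sin_neg in P. lra.
  - pose proof (sin_gt_0 x ltac:(lra) ltac:(lra)). lra.
Qed.

Lemma polar_inj (bet s t s' t' : R) :
  bet - PI < s < bet -> bet - PI < s' < bet -> polar s t = polar s' t' -> s = s' /\ t = t'.
Proof.
  intros Hs Hs' E. assert (N := f_equal Cnorm E). unfold polar in N.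
  rewrite !Cnorm_mul, !Cnorm_Cexpi, !Cnorm_RtoC, !Rabs_pos_eq in N by (left; apply exp_pos).
  assert (N' : exp (- t) = exp (- t')) by lra.
  assert (Et : t = t') by (apply exp_inv in N'; lra). split; [|exact Et]. subst t'.
  unfold polar, Cexpi, RtoC, Cmul in E. cbn [fst snd] in E. injection E as E1 E2.
  pose proof (exp_pos (- t)).
  assert (Ec : cos s = cos s') by (apply Rmult_eq_reg_l with (exp (- t)); lra).
  assert (Es : sin s = sin s') by (apply Rmult_eq_reg_l with (exp (- t)); lra).
  assert (s - s' = 0); [|lra]. apply sin_eq0_small; [lra|]. rewrite sin_minus, Ec, Es. ring.
Qed.

(** Cross-multiplying leaves [E - E'] times the determinant [e^{i bet} - e^{-i bet}] of the Moebius
    map. *)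
Lemma strip_map_inj (bet : R) (E E' : Cx) : 0 < bet < PI ->
  strip_den bet E <> Czero -> strip_den bet E' <> Czero ->
  strip_map bet E = strip_map bet E' -> E = E'.
Proof.
  intros Hb N N' H. pose proof (Cexpi_diff_neq0 bet Hb) as D.
  assert (X : ((E - Cone) * strip_den bet E')%cx = ((E' - Cone) * strip_den bet E)%cx).
  { transitivity (strip_map bet E * strip_den bet E * strip_den bet E')%cx;
      [unfold strip_map; field; exact N|].
    rewrite H. unfold strip_map. field. exact N'. }
  destruct (excluded_middle_informative (E = E')) as [Eq|Ne]; [exact Eq|exfalso].
  apply (Cmul_neq0 _ _ (Csub_neq0 _ _ Ne) D).
  transitivity ((E - Cone) * strip_den bet E' - (E' - Cone) * strip_den bet E)%cx.
  - unfold strip_den. ring.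
  - rewrite X. ring.
Qed.

Lemma strip_map_surj (bet : R) (z : Cx) : 0 < bet < PI -> inD z ->
  exists s t, bet - PI < s < bet /\ strip_map bet (polar s t) = z.
Proof.
  intros Hb Hz. set (p := Cexpi bet). set (q := Cexpi (- bet)).
  assert (Nq : (Cone + q * z)%cx <> Czero).
  { apply one_plus_neq0. unfold inD in *. unfold q. rewrite Cnorm_mul, Cnorm_Cexpi. lra. }
  assert (Epq : (q * p)%cx = Cone) by apply Cexpi_opp_mul.
  (* [E] is the forward map at [z]. The factor [i e^{-i bet}] rotates its half-plane
     [bet - PI < arg < bet] onto the right half-plane, where the argument is a plain [atan]. *)
  set (E := ((Cone + p * z) / (Cone + q * z))%cx). set (w := (CI * (q * E))%cx).
  assert (Hw : 0 < fst w).
  { pose proof (sqr_sum_neq0 _ Nq) as Hd.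
    set (d := fst (Cone + q * z)%cx * fst (Cone + q * z)%cx
              + snd (Cone + q * z)%cx * snd (Cone + q * z)%cx) in *.
    assert (Hd' : 0 < d) by (unfold d in *; nra).
    assert (Ew : w = (CI * ((q + z) * Cconj (Cone + q * z)) * RtoC (/ d))%cx).
    { unfold w, E. replace (q * ((Cone + p * z) / (Cone + q * z)))%cx
        with ((q + q * p * z) * Cinv (Cone + q * z))%cx by (unfold Cdiv; ring).
      rewrite Epq. replace (q + Cone * z)%cx with (q + z)%cx by ring.
      replace (Cinv (Cone + q * z)%cx) with (Cconj (Cone + q * z) * RtoC (/ d))%cx; [ring|].
      unfold Cinv. fold d. cx_unfold. unfold Rdiv. f_equal; ring. }
    rewrite Ew.
    assert (G : fst (CI * ((q + z) * Cconj (Cone + q * z)) * RtoC (/ d))%cx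
       = sin bet * (1 - Cnorm z * Cnorm z) * / d).
    { rewrite Cnorm_sqr. unfold q, Cexpi. cx_unfold. rewrite cos_neg, sin_neg.
      pose proof (sin2_cos2 bet) as P. unfold Rsqr in P.
      set (c := cos bet) in *. set (e := sin bet) in *.
      match goal with |- ?L = ?Q =>
        assert (L = Q + (e * e + c * c - 1) * (snd z * / d)) as -> by ring end.
      rewrite P. ring. }
    rewrite G. pose proof (sin_gt_0 bet ltac:(lra) ltac:(lra)). pose proof (Cnorm_ge0 z).
    unfold inD in Hz.
    apply Rmult_lt_0_compat; [apply Rmult_lt_0_compat; nra|apply Rinv_0_lt_compat; exact Hd']. }
  assert (Nw : w <> Czero) by (intros X; rewrite X in Hw; simpl in Hw; lra).
  pose (al := atan (snd w / fst w)).
  assert (Pw : w = (RtoC (Cnorm w) * Cexpi al)%cx).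
  { rewrite <- (Cexp_Clog w Nw) at 1. unfold Cexp, Clog, Arg. cbn [fst snd].
    rewrite exp_ln by (apply Cnorm_gt0, Nw). destruct (Rlt_dec 0 (fst w)); [reflexivity|lra]. }
  pose proof (atan_bound (snd w / fst w)) as Hal. fold al in Hal.
  (* The shift [bet - PI / 2] undoes the rotation, and [polar] has modulus [exp (- t)]. *)
  exists (bet - PI / 2 + al), (- ln (Cnorm w)). split; [lra|].
  assert (PE : polar (bet - PI / 2 + al) (- ln (Cnorm w)) = E).
  { unfold polar. rewrite Ropp_involutive, exp_ln by (apply Cnorm_gt0, Nw).
    replace (bet - PI / 2 + al) with (bet + (- (PI / 2)) + al) by ring. rewrite !Cexpi_add.
    fold p. replace (Cexpi (- (PI / 2))) with (- CI)%cx
      by (unfold Cexpi; rewrite cos_neg, sin_neg, cos_PI2, sin_PI2; cx_unfold; f_equal; ring).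
    transitivity (- CI * p * (RtoC (Cnorm w) * Cexpi al))%cx; [ring|]. rewrite <- Pw. unfold w.
    transitivity (- (CI * CI) * (q * p) * E)%cx; [ring|]. rewrite Epq.
    replace (CI * CI)%cx with (- Cone)%cx by (cx_unfold; f_equal; ring). ring. }
  rewrite PE. unfold strip_map, strip_den. fold p q.
  pose proof (Cexpi_diff_neq0 bet Hb) as D. fold p q in D.
  replace (E - Cone)%cx with (z * (p - q) / (Cone + q * z))%cx by (unfold E; field; exact Nq).
  replace (p - q * E)%cx with ((p - q) / (Cone + q * z))%cx.
  - field. auto.
  - unfold E. field. exact Nq.
Qed.

(** The derivative of [strip_map bet] in [log E], that is, [E d/dE]; [strip_deriv2] applies the same
    operator once more. *)
Definition strip_deriv1 (bet : R) (E : Cx) : Cx :=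
  (E * (Cexpi bet - Cexpi (- bet)) / (strip_den bet E * strip_den bet E))%cx.
Definition strip_deriv2 (bet : R) (E : Cx) : Cx :=
  (E * (Cexpi bet - Cexpi (- bet)) * (Cexpi bet + Cexpi (- bet) * E)
   / (strip_den bet E * strip_den bet E * strip_den bet E))%cx.

Lemma Cd_strip_den (bet : R) (k : Cx) (p : R -> Cx) (x : R) :
  Cd p x (k * p x)%cx ->
  Cd (fun y => strip_den bet (p y)) x (- (Cexpi (- bet) * (k * p x)))%cx.
Proof.
  intros Hp. unfold strip_den. eapply Cd_eq.
  - apply Cd_sub; [apply Cd_const|apply Cd_scal, Hp].
  - ring.
Qed.

(** The equation [p' = k p] covers both coordinates at once: [polar] satisfies it with [k = i] along
    [s] and [k = -1] along [t]. *)
Lemma Cd_strip_map (bet : R) (k : Cx) (p : R -> Cx) (x : R) :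
  strip_den bet (p x) <> Czero -> Cd p x (k * p x)%cx ->
  Cd (fun y => strip_map bet (p y)) x (k * strip_deriv1 bet (p x))%cx.
Proof.
  intros Hn Hp. unfold strip_map. eapply Cd_eq.
  - apply Cd_div; [exact Hn|apply Cd_sub; [exact Hp|apply Cd_const]|apply Cd_strip_den, Hp].
  - unfold strip_deriv1. unfold strip_den in *. field. exact Hn.
Qed.

Lemma Cd_strip_deriv1 (bet : R) (k : Cx) (p : R -> Cx) (x : R) :
  strip_den bet (p x) <> Czero -> Cd p x (k * p x)%cx ->
  Cd (fun y => strip_deriv1 bet (p y)) x (k * strip_deriv2 bet (p x))%cx.
Proof.
  intros Hn Hp. pose proof (Cd_strip_den bet k p x Hp) as Hd. unfold strip_deriv1. eapply Cd_eq.
  - apply Cd_div; [apply Cmul_neq0; exact Hn|apply Cd_mul; [exact Hp|apply Cd_const]|].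
    apply Cd_mul; exact Hd.
  - unfold strip_deriv2. cbv beta. unfold strip_den in *. field. exact Hn.
Qed.

Lemma Cd_polar_s (s t : R) : Cd (fun x => polar x t) s (CI * polar s t)%cx.
Proof.
  unfold polar. eapply Cd_eq.
  - apply Cd_scal. apply (Cd_Cexpi (fun x => x) s 1), is_derive_id_R.
  - change (RtoC 1) with Cone. ring.
Qed.

Lemma Cd_polar_t (s t : R) : Cd (fun x => polar s x) t (- Cone * polar s t)%cx.
Proof.
  unfold polar. eapply Cd_eq.
  - apply Cd_mul; [|apply Cd_const]. apply (Cd_RtoC (fun x => exp (- x)) t (- exp (- t))).
    auto_derive; [trivial|ring].
  - replace (RtoC (- exp (- t))) with (- RtoC (exp (- t)))%cx by (cx_unfold; f_equal; ring). ring.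
Qed.

(** The rotation carries the points [- e^{-i bet}] and [- e^{i bet}] singled out by [strip_map] to
    the zeros of the weight [(1 + e^{i (th + bet)} z) (1 + e^{i (th - bet)} z)]. *)
Definition strip_point (th bet s t : R) : Cx := (Cexpi (- th) * strip_map bet (polar s t))%cx.

Lemma strip_point_inD (th bet s t : R) : 0 < bet < PI -> bet - PI < s < bet ->
  inD (strip_point th bet s t).
Proof.
  intros Hb Hs. unfold inD, strip_point. rewrite Cnorm_mul, Cnorm_Cexpi, Rmult_1_l.
  apply strip_map_inD; assumption.
Qed.

Lemma strip_point_surj (th bet : R) (z : Cx) : 0 < bet < PI -> inD z ->
  exists s t, bet - PI < s < bet /\ strip_point th bet s t = z.
Proof.
  intros Hb Hz. destruct (strip_map_surj bet (Cexpi th * z)%cx Hb) as [s [t [Hs E]]].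
  { unfold inD in *. rewrite Cnorm_mul, Cnorm_Cexpi. lra. }
  exists s, t. split; [exact Hs|]. unfold strip_point. rewrite E.
  transitivity (Cexpi (- th) * Cexpi th * z)%cx; [ring|]. rewrite Cexpi_opp_mul. ring.
Qed.

Lemma strip_point_inj (th bet s t s' t' : R) : 0 < bet < PI ->
  bet - PI < s < bet -> bet - PI < s' < bet ->
  strip_point th bet s t = strip_point th bet s' t' -> s = s' /\ t = t'.
Proof.
  intros Hb Hs Hs' E. apply (polar_inj bet); try assumption.
  apply (strip_map_inj bet); try assumption; try (apply strip_den_neq0; assumption).
  transitivity (Cexpi (- - th) * Cexpi (- th) * strip_map bet (polar s t))%cx.
  - rewrite Cexpi_opp_mul. ring.
  - transitivity (Cexpi (- - th) * strip_point th bet s t)%cx; [unfold strip_point; ring|].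
    rewrite E. unfold strip_point.
    transitivity (Cexpi (- - th) * Cexpi (- th) * strip_map bet (polar s' t'))%cx; [ring|].
    rewrite Cexpi_opp_mul. ring.
Qed.

Lemma Ccont_strip_point {U : UniformSpace} (th bet : R) (f g : U -> R) (x : U) :
  0 < bet < PI -> bet - PI < f x < bet -> continuous f x -> continuous g x ->
  Ccont (fun y => strip_point th bet (f y) (g y)) x.
Proof.
  intros Hb Hs Hf Hg.
  assert (HE : Ccont (fun y => polar (f y) (g y)) x).
  { unfold polar. apply Ccont_mul; split; cbn [fst snd RtoC Cexpi].
    - apply (continuous_derivable_comp exp exp (fun y => - g y));
        [apply is_derive_Reals, derivable_pt_lim_exp|apply continuous_opp_R, Hg].
    - apply continuous_const.
    - apply (continuous_derivable_comp cos (fun x => - sin x) f);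
        [apply is_derive_Reals, derivable_pt_lim_cos|exact Hf].
    - apply (continuous_derivable_comp sin cos f);
        [apply is_derive_Reals, derivable_pt_lim_sin|exact Hf]. }
  unfold strip_point, strip_map. apply Ccont_mul; [apply Ccont_const|].
  apply Ccont_div; [apply strip_den_neq0; assumption| |].
  - apply Ccont_sub; [exact HE|apply Ccont_const].
  - unfold strip_den. apply Ccont_sub; [apply Ccont_const|].
    apply Ccont_mul; [apply Ccont_const|exact HE].
Qed.

(* First and second derivative of [e^{i th} Q] in the variable [log (polar s t) = - t + i s]. *)
Definition strip_d1 (th bet : R) (q : nat -> Cx) (s t : R) : Cx :=
  (PS (dco q) (strip_point th bet s t) * strip_deriv1 bet (polar s t))%cx.
Definition strip_d2 (th bet : R) (q : nat -> Cx) (s t : R) : Cx :=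
  (PS (dco (dco q)) (strip_point th bet s t) * Cexpi (- th)
     * strip_deriv1 bet (polar s t) * strip_deriv1 bet (polar s t)
   + PS (dco q) (strip_point th bet s t) * strip_deriv2 bet (polar s t))%cx.

Lemma Cd_strip_PS (th bet : R) (q : nat -> Cx) (k : Cx) (p : R -> Cx) (x : R) :
  summ q -> strip_den bet (p x) <> Czero -> inD (Cexpi (- th) * strip_map bet (p x))%cx ->
  Cd p x (k * p x)%cx ->
  Cd (fun y => Cexpi th * PS q (Cexpi (- th) * strip_map bet (p y)))%cx x
    (k * (PS (dco q) (Cexpi (- th) * strip_map bet (p x)) * strip_deriv1 bet (p x)))%cx /\
  Cd (fun y => PS (dco q) (Cexpi (- th) * strip_map bet (p y)) * strip_deriv1 bet (p y))%cx x
    (k * (PS (dco (dco q)) (Cexpi (- th) * strip_map bet (p x)) * Cexpi (- th)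
            * strip_deriv1 bet (p x) * strip_deriv1 bet (p x)
          + PS (dco q) (Cexpi (- th) * strip_map bet (p x)) * strip_deriv2 bet (p x)))%cx.
Proof.
  intros Hq Hn HD Hp. pose proof (Cd_strip_map bet k p x Hn Hp) as HT. split.
  - eapply Cd_eq; [apply Cd_scal, Cd_PS; [exact Hq|exact HD|apply Cd_scal, HT]|]. cbv beta.
    set (A := PS (dco q) _). set (B := strip_deriv1 _ _).
    transitivity (Cexpi (- th) * Cexpi th * (k * (A * B)))%cx; [ring|].
    rewrite Cexpi_opp_mul. ring.
  - eapply Cd_eq.
    + apply Cd_mul; [apply Cd_PS; [apply summ_dco, Hq|exact HD|apply Cd_scal, HT]|].
      apply (Cd_strip_deriv1 bet k p x Hn Hp).
    + cbv beta. ring.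
Qed.

(** Differentiating in [s] brings a factor [i], in [t] a factor [-1]; their squares are opposite, so
    the second derivatives cancel. *)
Lemma strip_increasing_harmonic (th bet : R) (q : nat -> Cx) :
  0 < bet < PI -> summ q ->
  (forall z, inD z -> 0 < fst (PS (dco q) z *
     ((Cone + Cexpi (th + bet) * z) * (Cone + Cexpi (th - bet) * z)))%cx) ->
  increasing_harmonic (bet - PI) bet
    (fun s t => snd (Cexpi th * PS q (strip_point th bet s t))%cx)
    (fun s t => snd (CI * strip_d1 th bet q s t)%cx)
    (fun s t => snd (CI * (CI * strip_d2 th bet q s t))%cx)
    (fun s t => snd (- Cone * strip_d1 th bet q s t)%cx)
    (fun s t => snd (- Cone * (- Cone * strip_d2 th bet q s t))%cx).
Proof.
  intros Hb Hq HP s t Hs.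
  pose proof (strip_den_neq0 bet s t Hb Hs) as Hn. pose proof (strip_point_inD th bet s t Hb Hs) as HD.
  destruct (Cd_strip_PS th bet q CI (fun x => polar x t) s Hq Hn HD (Cd_polar_s s t)) as [S1 S2].
  destruct (Cd_strip_PS th bet q (- Cone)%cx (polar s) t Hq Hn HD (Cd_polar_t s t)) as [T1 T2].
  refine (conj _ (conj _ (conj _ (conj _ (conj _ (conj _ _)))))).
  - apply continuity_2d_pt_filterlim.
    refine (proj2 (Ccont_mul (U := prod_UniformSpace R_UniformSpace R_UniformSpace)
      (fun _ => Cexpi th) (fun y => PS q (strip_point th bet (fst y) (snd y))) (s, t) _ _)).
    + apply Ccont_const.
    + apply Ccont_PS; [exact Hq|exact HD|].
      apply Ccont_strip_point; [exact Hb|exact Hs|apply continuous_fst|apply continuous_snd].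
  - exact (proj2 S1).
  - exact (proj2 (Cd_scal CI _ _ _ S2)).
  - exact (proj2 T1).
  - exact (proj2 (Cd_scal (- Cone)%cx _ _ _ T2)).
  - generalize (strip_d2 th bet q s t). intros X. cbn [fst snd Cmul Copp Cone CI]. ring.
  - specialize (HP _ HD). set (A := PS (dco q) (strip_point th bet s t)) in *.
    (* In strip coordinates the weighted [Q'] is [strip_d1] times [2 i sin bet]. Positive real part
       then says that [strip_d1] has negative imaginary part, and the [t]-derivative carries the
       factor [-1]. *)
    assert (G : (A * ((Cone + Cexpi (th + bet) * strip_point th bet s t)
                      * (Cone + Cexpi (th - bet) * strip_point th bet s t)))%cx
              = (strip_d1 th bet q s t * (Cexpi bet - Cexpi (- bet)))%cx).
    { assert (R1 : forall x, (Cexpi (th + x) * strip_point th bet s t)%cx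
          = (Cexpi x * strip_map bet (polar s t))%cx).
      { intros x. unfold strip_point. rewrite Cexpi_add.
        transitivity (Cexpi (- th) * Cexpi th * (Cexpi x * strip_map bet (polar s t)))%cx; [ring|].
        rewrite Cexpi_opp_mul. ring. }
      unfold Rminus. rewrite !R1. unfold strip_d1. fold A. unfold strip_deriv1, strip_map.
      unfold strip_den in *. field. exact Hn. }
    rewrite G, Cexpi_diff in HP. pose proof (sin_gt_0 bet ltac:(lra) ltac:(lra)).
    revert HP. generalize (strip_d1 th bet q s t). intros X HP.
    cbn [fst snd Cmul Copp Cone] in *. nra.
Qed.

(** * Level curves and the range of the harmonic map *)

(** Univalence and directional convexity at once: a level curve of [V] joins the two points, and
    along it the rotated [F] moves on a horizontal line without returning to its initial value at
    the end. *)
Lemma strip_fiber (th bet : R) (q : nat -> Cx) (F : Cx -> Cx) :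
  0 < bet < PI -> summ q ->
  (forall z, inD z -> 0 < fst (PS (dco q) z *
     ((Cone + Cexpi (th + bet) * z) * (Cone + Cexpi (th - bet) * z)))%cx) ->
  (forall z, inD z -> snd (Cexpi th * F z)%cx = snd (Cexpi th * PS q z)%cx) ->
  continuous_D F -> locally_univalent_D F ->
  forall z1 z2, inD z1 -> inD z2 -> z1 <> z2 ->
    snd (Cexpi th * F z1)%cx = snd (Cexpi th * F z2)%cx ->
    fst (Cexpi th * F z1)%cx <> fst (Cexpi th * F z2)%cx /\
    forall y, Rmin (fst (Cexpi th * F z1)%cx) (fst (Cexpi th * F z2)%cx) <= y
              <= Rmax (fst (Cexpi th * F z1)%cx) (fst (Cexpi th * F z2)%cx) ->
      exists z, inD z /\ (Cexpi th * F z)%cx = (y, snd (Cexpi th * F z1)%cx).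
Proof.
  intros Hb Hq HP HFQ HF HU.
  pose proof (strip_increasing_harmonic th bet q Hb Hq HP) as HV.
  set (V := fun s t => snd (Cexpi th * PS q (strip_point th bet s t))%cx) in HV.
  set (G := fun z => (Cexpi th * F z)%cx).
  (* Ordered abscissae suffice: the other order is symmetric, and equal abscissae on one level force
     equal points since [V] is strictly increasing in [t]. *)
  assert (main : forall s1 t1 s2 t2, bet - PI < s1 -> s1 < s2 -> s2 < bet -> V s1 t1 = V s2 t2 ->
    let z1 := strip_point th bet s1 t1 in let z2 := strip_point th bet s2 t2 in
    fst (G z1) <> fst (G z2) /\
    forall y, Rmin (fst (G z1)) (fst (G z2)) <= y <= Rmax (fst (G z1)) (fst (G z2)) ->
      exists z, inD z /\ G z = (y, V s1 t1)).
  { intros s1 t1 s2 t2 L1 L2 L3 E z1 z2.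
    destruct (increasing_harmonic_level_curve _ _ V _ _ _ _ s1 s2 t1 t2 (V s1 t1) HV L1
      ltac:(lra) L3 eq_refl (eq_sym E)) as [g [Hg Hlev]].
    assert (Hcl : forall x, bet - PI < clamp s1 s2 x < bet)
      by (intros x; pose proof (clamp_bounds s1 s2 x ltac:(lra)); lra).
    pose (P := fun x : R => strip_point th bet (clamp s1 s2 x) (g x)).
    assert (PD : forall x, inD (P x)) by (intros x; apply strip_point_inD; auto).
    assert (PC : forall x, Ccont (U := R_UniformSpace) P x).
    { intros x. apply (Ccont_strip_point (U := R_UniformSpace) th bet (clamp s1 s2) g); auto.
      - exact (proj1 (continuity_pt_filterlim _ _) (continuity_clamp s1 s2 x)).
      - exact (proj1 (continuity_pt_filterlim _ _) (Hg x)). }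
    assert (GS : forall x, snd (G (P x)) = V s1 t1)
      by (intros x; unfold G; rewrite HFQ by auto; apply Hlev).
    pose (X := fun x => fst (G (P x))).
    assert (XC : continuity X).
    { intros x. apply continuity_pt_filterlim.
      refine (proj1 (Ccont_mul (U := R_UniformSpace) (fun _ => Cexpi th) (fun x => F (P x)) x _ _)).
      - apply Ccont_const.
      - apply Ccont_comp_D; auto. }
    assert (Ginj : forall w w', G w = G w' -> F w = F w').
    { intros w w' H. unfold G in H.
      transitivity (Cexpi (- th) * Cexpi th * F w)%cx; [rewrite Cexpi_opp_mul; ring|].
      transitivity (Cexpi (- th) * (Cexpi th * F w'))%cx; [rewrite <- H; ring|].
      transitivity (Cexpi (- th) * Cexpi th * F w')%cx; [ring|rewrite Cexpi_opp_mul; ring]. }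
    (* The imaginary part is constant on the curve, so equal [X] means equal [F]; local univalence
       gives equal points, hence equal abscissae. *)
    assert (XI : locally_injective_on X s1 s2).
    { intros m Hm. destruct (HU (P m) (PD m)) as [r [Hr Hinj]].
      destruct (Ccont_norm _ _ (PC m) r Hr) as [d Hd]. exists d. split; [apply cond_pos|].
      intros x y Hx Hy Dx Dy EX.
      assert (EP : P x = P y).
      { apply (Hinj _ _ (PD x) (PD y) (Hd x Dx) (Hd y Dy)). apply Ginj.
        apply injective_projections; [exact EX|]. rewrite !GS. reflexivity. }
      unfold P in EP. rewrite !clamp_id in EP by assumption.
      apply (strip_point_inj th bet) in EP; [apply EP|exact Hb|lra|lra]. }
    (* Needed because [g] came from a choice: it identifies the ends of the curve with the given
       points. *)
    assert (Inj : forall s t t', bet - PI < s < bet -> V s t = V s t' -> t = t').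
    { intros s t t' Hs EV.
      pose proof (fun a b => increasing_harmonic_lt _ _ _ _ _ _ _ s a b HV Hs) as Inc.
      destruct (Rtotal_order t t') as [H|[H|H]]; [apply Inc in H; lra|exact H|apply Inc in H; lra]. }
    assert (P1 : P s1 = z1).
    { unfold P, z1. rewrite clamp_id by lra. f_equal. apply (Inj s1); [lra|].
      rewrite <- (clamp_id s1 s2 s1) at 1 by lra. apply Hlev. }
    assert (P2 : P s2 = z2).
    { unfold P, z2. rewrite clamp_id by lra. f_equal. apply (Inj s2); [lra|].
      rewrite <- (clamp_id s1 s2 s2) at 1 by lra. rewrite <- E. apply Hlev. }
    rewrite <- P1, <- P2. split.
    - exact (locally_injective_endpoints X s1 s2 XC L2 XI).
    - intros y Hy. destruct (IVT_gen X s1 s2 y XC Hy) as [x [_ Ex]].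
      exists (P x). split; [apply PD|]. apply injective_projections; [exact Ex|apply GS]. }
  intros z1 z2 H1 H2 Hne Hs. fold (G z1) (G z2) in *.
  destruct (strip_point_surj th bet z1 Hb H1) as [s1 [t1 [B1 E1]]].
  destruct (strip_point_surj th bet z2 Hb H2) as [s2 [t2 [B2 E2]]].
  assert (V1 : V s1 t1 = snd (G z1)) by (unfold V, G; rewrite E1, HFQ by exact H1; reflexivity).
  assert (V2 : V s2 t2 = snd (G z2)) by (unfold V, G; rewrite E2, HFQ by exact H2; reflexivity).
  destruct (Rtotal_order s1 s2) as [L|[L|L]].
  - destruct (main s1 t1 s2 t2 ltac:(lra) L ltac:(lra) ltac:(lra)) as [M1 M2].
    rewrite E1, E2, V1 in *. auto.
  - exfalso. apply Hne. rewrite <- E1, <- E2. subst s2. f_equal.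
    pose proof (fun a b => increasing_harmonic_lt _ _ _ _ _ _ _ s1 a b HV B1) as Inc.
    fold V in Inc.
    destruct (Rtotal_order t1 t2) as [H|[H|H]]; [apply Inc in H; lra|exact H|apply Inc in H; lra].
  - destruct (main s2 t2 s1 t1 ltac:(lra) L ltac:(lra) ltac:(lra)) as [M1 M2].
    rewrite E1, E2, V2 in *. split; [auto|]. rewrite Rmin_comm, Rmax_comm, Hs. exact M2.
Qed.

Lemma strip_convex_in_direction (th bet : R) (q : nat -> Cx) (F : Cx -> Cx) :
  0 < bet < PI -> summ q ->
  (forall z, inD z -> 0 < fst (PS (dco q) z *
     ((Cone + Cexpi (th + bet) * z) * (Cone + Cexpi (th - bet) * z)))%cx) ->
  (forall z, inD z -> snd (Cexpi th * F z)%cx = snd (Cexpi th * PS q z)%cx) ->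
  continuous_D F -> locally_univalent_D F ->
  convex_in_direction F (- th).
Proof.
  intros Hb Hq HP HFQ HF HU.
  pose proof (strip_fiber th bet q F Hb Hq HP HFQ HF HU) as Fib. split.
  - intros z w Hz Hw E. destruct (excluded_middle_informative (z = w)) as [Q|Q]; [exact Q|].
    exfalso. destruct (Fib z w Hz Hw Q ltac:(rewrite E; reflexivity)) as [N _].
    apply N. rewrite E. reflexivity.
  - intros z1 z2 H1 H2 HI t Ht. rewrite Ropp_involutive in HI.
    destruct (excluded_middle_informative (z1 = z2)) as [<-|Q].
    { exists z1. split; [exact H1|]. change (F z1 = F z1 + RtoC t * (F z1 - F z1))%cx. ring. }
    assert (HS : snd (Cexpi th * F z1)%cx = snd (Cexpi th * F z2)%cx).
    { assert (HI' : snd (Cexpi th * F z2)%cx - snd (Cexpi th * F z1)%cx = 0)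
        by (rewrite <- HI; cx_unfold; ring). lra. }
    destruct (Fib z1 z2 H1 H2 Q HS) as [_ Fy].
    set (x1 := fst (Cexpi th * F z1)%cx) in *. set (x2 := fst (Cexpi th * F z2)%cx) in *.
    destruct (Fy (x1 + t * (x2 - x1))) as [z [Hz Ez]].
    { unfold Rmin, Rmax. destruct (Rle_dec x1 x2); nra. }
    exists z. split; [exact Hz|].
    assert (E : (Cexpi th * F z)%cx
        = (Cexpi th * (F z1 + RtoC t * (F z2 - F z1)))%cx).
    { transitivity ((Cexpi th * F z1) + RtoC t * (Cexpi th * F z2 - Cexpi th * F z1))%cx; [|ring].
      rewrite Ez. apply injective_projections.
      - unfold x1, x2. cx_unfold. ring.
      - change (snd (Cexpi th * F z1)%cx = snd (Cexpi th * F z1)%cx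
          + (t * (snd (Cexpi th * F z2)%cx + - snd (Cexpi th * F z1)%cx)
             + 0 * (fst (Cexpi th * F z2)%cx + - fst (Cexpi th * F z1)%cx))).
        rewrite <- HS. ring. }
    transitivity (Cexpi (- th) * Cexpi th * F z)%cx; [rewrite Cexpi_opp_mul; ring|].
    transitivity (Cexpi (- th) * (Cexpi th * F z))%cx; [ring|]. rewrite E.
    change (Cadd (F z1) (Cmul (RtoC t) (Csub (F z2) (F z1)))) with (F z1 + RtoC t * (F z2 - F z1))%cx.
    set (Y := (F z1 + RtoC t * (F z2 - F z1))%cx).
    transitivity (Cexpi (- th) * Cexpi th * Y)%cx; [ring|rewrite Cexpi_opp_mul; ring].
Qed.

(** * The convolution *)

Lemma summ_le (a b : nat -> Cx) : (forall n, Cnorm (b n) <= Cnorm (a n)) -> summ a -> summ b.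
Proof.
  intros H Ha. apply summ_of_bounded. intros r Hr.
  destruct (summ_bounded a r Ha Hr) as [M HM]. exists M. intros n.
  eapply Rle_trans; [|apply (HM n)]. apply Rmult_le_compat_r; [apply pow_le; lra|apply H].
Qed.

Lemma summ_incr_1 (a : nat -> Cx) : summ a -> summ (fun n => a (S n)).
Proof.
  intros Ha. apply (summ_le (dco a)); [|apply summ_dco, Ha]. intros n. unfold dco.
  rewrite Cnorm_mul, Cnorm_RtoC, Rabs_pos_eq, S_INR by apply pos_INR.
  pose proof (pos_INR n). pose proof (Cnorm_ge0 (a (S n))). nra.
Qed.

Lemma PS_0 (a : nat -> Cx) : summ a -> PS a Czero = a O.
Proof.
  intros Ha. rewrite PS_incr_1; [ring|exact Ha|]. unfold inD. rewrite Cnorm_0. lra.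
Qed.

Lemma PS_comb (a b : nat -> Cx) (k z : Cx) : summ a -> summ b -> inD z ->
  PS (fun n => a n + k * b n)%cx z = (PS a z + k * PS b z)%cx.
Proof.
  intros Ha Hb Hz. rewrite <- (PS_scal k b z Hb Hz).
  apply (PS_add a (fun n => k * b n)%cx z Ha (summ_scal k b Hb) Hz).
Qed.

Lemma summ_comb (a b : nat -> Cx) (k : Cx) : summ a -> summ b -> summ (fun n => a n + k * b n)%cx.
Proof. intros Ha Hb. apply (summ_add a (fun n => k * b n)%cx Ha (summ_scal k b Hb)). Qed.

Lemma PS_dco_comb (a b : nat -> Cx) (k z : Cx) : summ a -> summ b -> inD z ->
  PS (dco (fun n => a n + k * b n)%cx) z = (PS (dco a) z + k * PS (dco b) z)%cx.
Proof.
  intros Ha Hb Hz. rewrite <- (PS_comb (dco a) (dco b) k z) by (try apply summ_dco; assumption).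
  apply PS_ext. intros n. unfold dco. ring.
Qed.

(** The half-plane map has geometric coefficients, and multiplying by [u ^ n] rotates the
    argument. *)
Lemma half_plane_convolution_deriv (c k : nat -> Cx) (A u z : Cx) :
  summ c -> summ k -> Cnorm u = 1 -> inD z ->
  (forall z, inD z -> PS c z = (A * z / (Cone - u * z))%cx) ->
  PS (dco (fun n => c n * k n)%cx) z = (A * PS (dco k) (u * z))%cx.
Proof.
  intros Hc Hk Hu Hz H. pose proof (half_plane_coeffs c A u Hc Hu H) as E.
  assert (Hs : summ (fun n => u ^ n * dco k n)%cx)
    by (apply (summ_hadamard (fun n => u ^ n)%cx); [apply summ_pow, Hu|apply summ_dco, Hk]).
  rewrite <- PS_rot, <- PS_scal by assumption. apply PS_ext. intros n.
  unfold dco. rewrite E. ring.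
Qed.

(** The coefficients [u^{n+1} - v^{n+1}], multiplied into [k], are those of [k (u z) - k (v z)]
    shifted by one index; the constant term of that difference cancels. *)
Lemma strip_convolution_deriv (c k : nat -> Cx) (B u v z : Cx) :
  summ c -> summ k -> Cnorm u = 1 -> Cnorm v = 1 -> u <> v -> inD z ->
  (forall z, inD z -> PS (dco c) z = (B / ((Cone - u * z) * (Cone - v * z)))%cx) ->
  z <> Czero ->
  PS (dco (fun n => c n * k n)%cx) z
  = (B * ((PS k (u * z) - PS k (v * z)) / (u * z - v * z)))%cx.
Proof.
  intros Hc Hk Hu Hv Huv Hz H Hz0. pose proof (Csub_neq0 _ _ Huv) as Nuv.
  pose proof (strip_coeffs (dco c) B u v (summ_dco c Hc) Hu Hv Huv H) as E.
  assert (Su : summ (fun n => u ^ n * k n)%cx)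
    by (apply (summ_hadamard (fun n => u ^ n)%cx); [apply summ_pow, Hu|exact Hk]).
  assert (Sv : summ (fun n => v ^ n * k n)%cx)
    by (apply (summ_hadamard (fun n => v ^ n)%cx); [apply summ_pow, Hv|exact Hk]).
  pose (d := fun n => (u ^ n * k n + (- Cone) * (v ^ n * k n))%cx).
  assert (Sd : summ d) by (apply summ_comb; assumption).
  assert (Ed : PS d z = (PS k (u * z) - PS k (v * z))%cx).
  { unfold d. rewrite (PS_comb (fun n => u ^ n * k n)%cx (fun n => v ^ n * k n)%cx) by assumption.
    rewrite !PS_rot. ring. }
  rewrite PS_incr_1 in Ed by assumption.
  assert (Ed' : PS (dco (fun n => c n * k n)%cx) z = (B / (u - v) * PS (fun n => d (S n)) z)%cx).
  { rewrite <- PS_scal by (try (apply (summ_incr_1 d)); assumption). apply PS_ext. intros n.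
    transitivity (dco c n * k (S n))%cx; [unfold dco; ring|]. rewrite E. unfold d. ring. }
  rewrite Ed', <- Ed. unfold d at 2. simpl Cpow.
  replace (u * z - v * z)%cx with ((u - v) * z)%cx by ring. field. auto.
Qed.

(** Both products acquire the same weight [W]: the condition on [k2] is evaluated at [m z], the
    divided difference of [k1] at [u z] and [v z]. So their real parts add. The factor [Cone] fits
    the shape of [PS_dco_comb]. *)
Lemma convolution_shear_Re_pos (c1 k1 c2 k2 : nat -> Cx) (A B : R) (m u v : Cx) :
  summ c1 -> summ k1 -> summ c2 -> summ k2 -> 0 < A -> 0 < B ->
  Cnorm m = 1 -> Cnorm u = 1 -> Cnorm v = 1 -> u <> v ->
  (forall z, inD z -> PS c1 z = (RtoC A * z / (Cone - m * z))%cx) ->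
  (forall z, inD z -> PS (dco c2) z = (RtoC B / ((Cone - u * z) * (Cone - v * z)))%cx) ->
  (forall z, inD z -> 0 < fst (PS (dco k1) z * Cconj (PS (dco c1) z))%cx) ->
  (forall z, inD z -> 0 < fst (PS (dco k2) z * Cconj (PS (dco c2) z))%cx) ->
  forall z, inD z ->
    0 < fst (PS (dco (fun n => c1 n * k2 n + Cone * (c2 n * k1 n))%cx) z
             * ((Cone - m * u * z) * (Cone - m * v * z)))%cx.
Proof.
  intros Hc1 Hk1 Hc2 Hk2 HA HB Hm Hu Hv Huv H1 H2 P1 P2 z Hz.
  assert (Hrot : forall w x, Cnorm w = 1 -> inD x -> inD (w * x)%cx)
    by (intros w x Hw Hx; unfold inD in *; rewrite Cnorm_mul, Hw; lra).
  assert (P1' : forall z, inD z -> 0 < fst (PS (dco k1) z * ((Cone - m * z) * (Cone - m * z)))%cx).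
  { intros x Hx. pose proof (one_sub_neq0 m x Hm Hx). apply (Re_ratio_pos _ _ A HA).
    - apply Cmul_neq0; assumption.
    - rewrite <- (half_plane_deriv c1 (RtoC A) m Hc1 Hm H1 x Hx). apply P1, Hx. }
  assert (P2' : forall z, inD z -> 0 < fst (PS (dco k2) z * ((Cone - u * z) * (Cone - v * z)))%cx).
  { intros x Hx. apply (Re_ratio_pos _ _ B HB).
    - apply Cmul_neq0; apply one_sub_neq0; assumption.
    - rewrite <- (H2 x Hx). apply P2, Hx. }
  set (W := ((Cone - m * u * z) * (Cone - m * v * z))%cx).
  assert (T1 : 0 < fst (PS (dco (fun n => c1 n * k2 n)%cx) z * W)%cx).
  { rewrite (half_plane_convolution_deriv c1 k2 (RtoC A) m z) by assumption.
    specialize (P2' _ (Hrot m z Hm Hz)).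
    replace ((Cone - u * (m * z)) * (Cone - v * (m * z)))%cx with W in P2' by (unfold W; ring).
    set (X := PS (dco k2) (m * z)%cx) in *.
    replace (fst (RtoC A * X * W)%cx) with (A * fst (X * W)%cx)
      by (unfold RtoC, Cmul; cbn [fst snd]; ring).
    apply Rmult_lt_0_compat; assumption. }
  assert (T2 : 0 < fst (PS (dco (fun n => c2 n * k1 n)%cx) z * W)%cx).
  (* At the centre the divided difference degenerates; there the derivative is the product of the
     two leading derivative coefficients. *)
  { destruct (excluded_middle_informative (z = Czero)) as [Z|Z].
    - assert (D0 : inD Czero) by (rewrite <- Z; exact Hz).
      assert (EW : W = Cone) by (unfold W; rewrite Z; ring).
      rewrite EW, Z, PS_0 by (apply summ_dco, summ_hadamard; assumption).
      specialize (P1' _ D0). rewrite PS_0 in P1' by (apply summ_dco; assumption).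
      specialize (H2 _ D0). rewrite PS_0 in H2 by (apply summ_dco; assumption).
      replace (dco (fun n => c2 n * k1 n)%cx 0%nat) with (dco c2 0%nat * dco k1 0%nat)%cx
        by (unfold dco; change (RtoC (INR 1)) with Cone; ring).
      rewrite H2. replace (RtoC B / ((Cone - u * Czero) * (Cone - v * Czero)))%cx with (RtoC B).
      2: { replace ((Cone - u * Czero) * (Cone - v * Czero))%cx with Cone by ring.
           field. exact Cone_neq0. }
      set (X := dco k1 0%nat) in *.
      replace ((Cone - m * Czero) * (Cone - m * Czero))%cx with Cone in P1' by ring.
      replace (fst (RtoC B * X * Cone)%cx) with (B * fst (X * Cone)%cx)
        by (unfold RtoC, Cmul; cbn [fst snd]; ring).
      apply Rmult_lt_0_compat; assumption.
    - rewrite (strip_convolution_deriv c2 k1 (RtoC B) u v z) by assumption.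
      assert (Ne : (u * z)%cx <> (v * z)%cx).
      { intros E. apply (Cmul_neq0 _ _ (Csub_neq0 _ _ Huv) Z).
        transitivity (u * z - v * z)%cx; [ring|]. rewrite E. ring. }
      pose proof (divided_difference_Re_pos k1 m (u * z)%cx (v * z)%cx Hk1 Hm P1'
        (Hrot u z Hu Hz) (Hrot v z Hv Hz) Ne) as Q.
      replace ((Cone - m * (u * z)) * (Cone - m * (v * z)))%cx with W in Q by (unfold W; ring).
      set (X := ((PS k1 (u * z) - PS k1 (v * z)) / (u * z - v * z))%cx) in *.
      replace (fst (RtoC B * X * W)%cx) with (B * fst (X * W)%cx)
        by (unfold RtoC, Cmul; cbn [fst snd]; ring).
      apply Rmult_lt_0_compat; assumption. }
  rewrite (PS_dco_comb (fun n => c1 n * k2 n)%cx (fun n => c2 n * k1 n)%cx)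
    by (try apply summ_hadamard; assumption).
  set (X := PS (dco (fun n => c1 n * k2 n)%cx) z) in *.
  set (Y := PS (dco (fun n => c2 n * k1 n)%cx) z) in *.
  replace ((X + Cone * Y) * W)%cx with (X * W + Y * W)%cx by ring.
  change (0 < fst (X * W)%cx + fst (Y * W)%cx). lra.
Qed.

Lemma sense_preserving_shear_Re_pos (f : harm) (e : Cx) :
  is_harmonic_D f -> sense_preserving f -> Cnorm e = 1 ->
  forall z, inD z ->
    0 < fst (PS (dco (fun n => hco f n + - e * gco f n)%cx) z
             * Cconj (PS (dco (fun n => hco f n + e * gco f n)%cx) z))%cx.
Proof.
  intros [Ah Ag] Hs He z Hz. apply summ_of_analytic in Ah, Ag.
  destruct (Hs z Hz) as [dh [dg [Dh [Dg Hlt]]]].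
  apply (Cderiv_PS (hco f)) in Dh; [|exact Ah|exact Hz|intros w Hw; apply psum_PS; assumption].
  apply (Cderiv_PS (gco f)) in Dg; [|exact Ag|exact Hz|intros w Hw; apply psum_PS; assumption].
  rewrite !PS_dco_comb, <- Dh, <- Dg by assumption.
  replace (dh + - e * dg)%cx with (dh - e * dg)%cx by ring.
  apply sense_preserving_Re_pos; assumption.
Qed.

Lemma fval_PS (f : harm) (z : Cx) : summ (hco f) -> summ (gco f) -> inD z ->
  fval f z = (PS (hco f) z + Cconj (PS (gco f) z))%cx.
Proof. intros Hh Hg Hz. unfold fval, hf, gf. rewrite !psum_PS by assumption. reflexivity. Qed.

Lemma fval_continuous_D (f : harm) : summ (hco f) -> summ (gco f) -> continuous_D (fval f).
Proof.
  intros Hh Hg z Hz e He.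
  destruct (PS_continuous _ z Hh Hz (e / 2) ltac:(lra)) as [d1 [D1 H1]].
  destruct (PS_continuous _ z Hg Hz (e / 2) ltac:(lra)) as [d2 [D2 H2]].
  exists (Rmin d1 d2). split; [apply Rmin_pos; assumption|]. intros w Hw Hd.
  pose proof (Rmin_l d1 d2). pose proof (Rmin_r d1 d2).
  destruct (H1 w ltac:(lra)) as [_ B1]. destruct (H2 w ltac:(lra)) as [_ B2].
  rewrite !fval_PS by assumption.
  set (x := PS (hco f) w) in *. set (x' := PS (hco f) z) in *.
  set (y := PS (gco f) w) in *. set (y' := PS (gco f) z) in *.
  replace (x + Cconj y - (x' + Cconj y'))%cx with ((x - x') + Cconj (y - y'))%cx
    by (unfold Csub, Cadd, Copp, Cconj; cbn [fst snd]; f_equal; ring).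
  eapply Rle_lt_trans; [apply Cnorm_triangle|].
  replace (Cnorm (Cconj (y - y')%cx)) with (Cnorm (y - y')%cx); [lra|].
  unfold Cnorm, Cconj; cbn [fst snd]. f_equal. ring.
Qed.

Theorem theorem1 :
  forall (a b : Cx) (gam bet : R) (f1 f2 : harm),
    inD a -> inD b ->
    0 <= gam < 2 * PI -> 0 < bet < PI ->
    let a' := Cnorm (Cadd Cone a) - 1 in
    let b' := Cnorm (Cadd Cone b) - 1 in
    let gam_a := Arg (Cadd Cone (Cconj a)) in
    let gam_b := Arg (Cadd Cone (Cconj b)) in
    S_H_onto f1 (Hdom a gam) ->
    (forall z, inD z ->
       Cadd (hf f1 z) (Cmul (Cexpi (-2 * (gam + gam_a))) (gf f1 z)) =
       Cdiv (Cmul (RtoC (1 + a')) z)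
            (Csub Cone (Cmul (Cexpi (gam + gam_a)) z))) ->
    S_H_onto f2 (Omdom b bet) ->
    (forall z, inD z ->
       Cadd (hf f2 z) (Cmul (Cexpi (-2 * gam_b)) (gf f2 z)) =
       Cmul (Cdiv (Cmul (RtoC (1 + b')) (Cexpi (- gam_b)))
                  (Cmul (Cmul (RtoC 2) CI) (RtoC (sin bet))))
            (Clog (Cdiv (Cadd Cone (Cmul z (Cexpi (bet + gam_b))))
                        (Cadd Cone (Cmul z (Cexpi (- (bet - gam_b)))))))) ->
    locally_univalent_D (fval (hconv f1 f2)) ->
    univalent_D (fval (hconv f1 f2)) /\
    convex_in_direction (fval (hconv f1 f2)) (- (gam + gam_a + gam_b)).
Proof.
  intros a b gam bet f1 f2 Ha Hb _ Hbet a' b' gam_a gam_b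
    [[[HD1 _] [HS1 _]] _] HF1 [[[HD2 _] [HS2 _]] _] HF2 HU.
  (* Univalence is a component of [convex_in_direction]. *)
  enough (convex_in_direction (fval (hconv f1 f2)) (- (gam + gam_a + gam_b))) as C
    by (split; [apply C|exact C]).
  assert (HA : 0 < 1 + a') by (pose proof (Cnorm_gt0 _ (one_plus_neq0 a Ha)); unfold a'; lra).
  assert (HB : 0 < 1 + b') by (pose proof (Cnorm_gt0 _ (one_plus_neq0 b Hb)); unfold b'; lra).
  clearbody a' b' gam_a gam_b.
  pose proof (summ_of_analytic _ (proj1 HD1)) as Sh1. pose proof (summ_of_analytic _ (proj2 HD1)) as Sg1.
  pose proof (summ_of_analytic _ (proj1 HD2)) as Sh2. pose proof (summ_of_analytic _ (proj2 HD2)) as Sg2.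
  set (phi := gam + gam_a) in *. set (e := Cexpi (-2 * phi)) in *. set (e' := Cexpi (-2 * gam_b)) in *.
  pose proof (Cnorm_Cexpi (-2 * phi) : Cnorm e = 1) as Ne.
  pose proof (Cnorm_Cexpi (-2 * gam_b) : Cnorm e' = 1) as Ne'.
  pose proof (sense_preserving_shear_Re_pos f1 e HD1 HS1 Ne) as P1.
  pose proof (sense_preserving_shear_Re_pos f2 e' HD2 HS2 Ne') as P2.
  set (c1 := fun n => (hco f1 n + e * gco f1 n)%cx) in P1.
  set (k1 := fun n => (hco f1 n + - e * gco f1 n)%cx) in P1.
  set (c2 := fun n => (hco f2 n + e' * gco f2 n)%cx) in P2.
  set (k2 := fun n => (hco f2 n + - e' * gco f2 n)%cx) in P2.
  assert (Sc1 : summ c1) by (apply summ_comb; assumption).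
  assert (Sk1 : summ k1) by (apply summ_comb; assumption).
  assert (Sc2 : summ c2) by (apply summ_comb; assumption).
  assert (Sk2 : summ k2) by (apply summ_comb; assumption).
  assert (E1 : forall z, inD z -> PS c1 z = (RtoC (1 + a') * z / (Cone - Cexpi phi * z))%cx).
  { intros z Hz. rewrite <- (HF1 z Hz). unfold hf, gf. rewrite !psum_PS by assumption.
    apply PS_comb; assumption. }
  (* The signs bring the factors of the logarithm to the form [1 - u z] and [1 - v z]. *)
  set (u := (- Cexpi (bet + gam_b))%cx). set (v := (- Cexpi (- (bet - gam_b)))%cx).
  assert (Nu : Cnorm u = 1) by (unfold u; rewrite Cnorm_opp; apply Cnorm_Cexpi).
  assert (Nv : Cnorm v = 1) by (unfold v; rewrite Cnorm_opp; apply Cnorm_Cexpi).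
  assert (Evu : (v - u)%cx = (Cexpi gam_b * (Cexpi bet - Cexpi (- bet)))%cx).
  { unfold u, v. replace (- (bet - gam_b)) with (- bet + gam_b) by ring. rewrite !Cexpi_add. ring. }
  assert (Nvu : (v - u)%cx <> Czero).
  { rewrite Evu. apply Cmul_neq0; [apply Cexpi_neq0|apply Cexpi_diff_neq0, Hbet]. }
  assert (Huv : u <> v) by (intros X; apply Nvu; rewrite X; ring).
  set (K := Cdiv (Cmul (RtoC (1 + b')) (Cexpi (- gam_b)))
                 (Cmul (Cmul (RtoC 2) CI) (RtoC (sin bet)))) in HF2.
  assert (ED : (RtoC 2 * CI * RtoC (sin bet))%cx = (Cexpi bet - Cexpi (- bet))%cx).
  { rewrite Cexpi_diff. unfold RtoC, CI, Cmul; cbn [fst snd]. f_equal; ring. }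
  pose proof (Cexpi_diff_neq0 bet Hbet) as ND.
  (* The logarithm contributes [v - u = e^{i gam_b} 2 i sin bet], which the prescribed prefactor
     cancels down to a positive real numerator. *)
  assert (HK : (K * (v - u))%cx = RtoC (1 + b')).
  { unfold K. rewrite ED, Evu.
    transitivity (Cexpi (- gam_b) * Cexpi gam_b * RtoC (1 + b'))%cx; [field; exact ND|].
    rewrite Cexpi_opp_mul. ring. }
  assert (NK : K <> Czero).
  { intros X. rewrite X in HK. assert (X' := f_equal fst HK).
    unfold Cmul, Czero, RtoC in X'. cbn [fst snd] in X'. lra. }
  assert (E2 : forall z, inD z ->
    PS (dco c2) z = (RtoC (1 + b') / ((Cone - u * z) * (Cone - v * z)))%cx).
  { rewrite <- HK. apply log_quotient_deriv; try assumption. intros z Hz.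
    replace (Cone - u * z)%cx with (Cone + z * Cexpi (bet + gam_b))%cx by (unfold u; ring).
    replace (Cone - v * z)%cx with (Cone + z * Cexpi (- (bet - gam_b)))%cx by (unfold v; ring).
    etransitivity; [|exact (HF2 z Hz)]. unfold hf, gf. rewrite !psum_PS by assumption.
    apply PS_comb; assumption. }
  pose proof (convolution_shear_Re_pos c1 k1 c2 k2 (1 + a') (1 + b') (Cexpi phi) u v
    Sc1 Sk1 Sc2 Sk2 HA HB (Cnorm_Cexpi phi) Nu Nv Huv E1 E2 P1 P2) as Pos.
  set (f := hconv f1 f2) in *.
  assert (Sh : summ (hco f)) by (apply (summ_hadamard (hco f1) (hco f2)); assumption).
  assert (Sg : summ (gco f)) by (apply (summ_hadamard (gco f1) (gco f2)); assumption).
  pose (th := phi + gam_b). fold th.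
  assert (Eee : (e * e')%cx = Cexpi (-2 * th)).
  { unfold e, e', th. rewrite <- Cexpi_add. f_equal. ring. }
  pose (q := fun n => (hco f n + - Cexpi (-2 * th) * gco f n)%cx).
  assert (Sq : summ q) by (apply summ_comb; assumption).
  apply (strip_convex_in_direction th bet q); try assumption.
  - intros z Hz. specialize (Pos z Hz).
    replace (Cone - Cexpi phi * u * z)%cx with (Cone + Cexpi (th + bet) * z)%cx in Pos.
    2: { unfold u, th. replace (phi + gam_b + bet) with (phi + (bet + gam_b)) by ring.
         rewrite (Cexpi_add phi). ring. }
    replace (Cone - Cexpi phi * v * z)%cx with (Cone + Cexpi (th - bet) * z)%cx in Pos.
    2: { unfold v, th. replace (phi + gam_b - bet) with (phi + - (bet - gam_b)) by ring.
         rewrite (Cexpi_add phi). ring. }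
    rewrite (PS_ext _ (fun n => RtoC 2 * dco q n)%cx) in Pos.
    2: { intros n. unfold dco, q. rewrite <- Eee. unfold f, hconv, c1, c2, k1, k2. cbn [hco gco].
         replace (RtoC 2) with (Cone + Cone)%cx by (unfold Cone, Cadd, RtoC; cbn [fst snd]; f_equal; ring).
         ring. }
    rewrite PS_scal in Pos by (try apply summ_dco; assumption).
    set (X := PS (dco q) z) in *. 
    set (Y := ((Cone + Cexpi (th + bet) * z) * (Cone + Cexpi (th - bet) * z))%cx) in *.
    replace (fst (RtoC 2 * X * Y)%cx) with (2 * fst (X * Y)%cx) in Pos
      by (unfold RtoC, Cmul; cbn [fst snd]; ring).
    lra.
  - intros z Hz. unfold q. rewrite fval_PS, PS_comb by assumption.
    set (X := PS (hco f) z). set (Y := PS (gco f) z).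
    (* [e^{i th}] times the conjugate of [Y] is the conjugate of [e^{-i th} Y], so its imaginary
       part is that of [- e^{-i th} Y]. *)
    replace (Cexpi th * (X + - Cexpi (-2 * th) * Y))%cx with (Cexpi th * X - Cexpi (- th) * Y)%cx.
    2: { replace (- th) with (th + -2 * th) by ring. rewrite Cexpi_add. ring. }
    unfold Cexpi, Csub, Copp, Cadd, Cmul, Cconj; cbn [fst snd]. rewrite cos_neg, sin_neg. ring.
  - apply fval_continuous_D; assumption.
Qed.
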